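(* Let $T(2,n)$ be a torus knot of type $(2,n)$ with $n>0$ (the term ''torus knot'' here includes the two-component torus links that occur for even $n$), represented by its standard $n$-crossing diagram. Its Khovanov homology $H_{a,b}(T(2,n))$ is given by $$ H_{a,b}(T(2,n)) = \begin{cases} \mathbb{Z} & \text{for } (a,b)=(n,n) \text{ or } (a,b)=(-n,-3n),\\ \mathbb{Z} & \text{for } a=n-2s,\ b=n-4s+4 \text{ where } s \text{ is even and } 0\le s\le n,\\ \mathbb{Z} & \text{for } a=n-2s,\ b=n-4s \text{ where } s \text{ is odd and } 3\le s\le n,\\ \mathbb{Z}_2 & \text{for } a=n-2s,\ b=n-4s+4 \text{ where } s \text{ is odd and } 3\le s\le n,\\ 0 & \text{otherwise.} \end{cases} $$
   Context: Let $D$ be an unoriented link diagram with set of crossings $cr(D)$. Smoothings: at a crossing whose over-strand runs from top-left to bottom-right (and under-strand from bottom-left to top-right), the $A$-smoothing replaces the crossing by two arcs, one joining the top-left end to the top-right end and the other joining the bottom-left end to the bottom-right end; the $B$-smoothing joins top-left to bottom-left and top-right to bottom-right. Kauffman state: a function $s: cr(D)\to\{A,B\}$. $D_s$ denotes the system of circles obtained by smoothing every crossing according to $s$. Enhanced Kauffman state: a Kauffman state $s$ together with a function $\varepsilon: D_s\to\{+,-\}$ assigning a sign to each circle of $D_s$. The set of these is $EKS$. Put $\sigma(s)=|s^{-1}(A)|-|s^{-1}(B)|$ and $\tau(S)=|\varepsilon^{-1}(+)|-|\varepsilon^{-1}(-)|$. Chain groups: $\mathcal{S}_{a,b}(D)=\{S\in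 EKS : a=\sigma(s),\ b=\sigma(s)+2\tau(S)\}$ and $\mathcal{C}_{a,b}(D)=\mathbb{Z}\mathcal{S}_{a,b}(D)$ is the free abelian group on it. Differential: fix an ordering of the crossings and define $\partial_{a,b}:\mathcal{C}_{a,b}\to\mathcal{C}_{a-2,b}$ by $\partial_{a,b}(S)=\sum_{S'\in\mathcal{S}_{a-2,b}}(-1)^{t(S,S')}(S,S')S'$. Here the incidence number $(S,S')\in\{0,1\}$ equals $1$ if and only if (1) the underlying states $s,s'$ agree except at exactly one crossing $v$, where $s(v)=A$ and $s'(v)=B$; and (2) $\tau(S')=\tau(S)+1$ and every circle of $D_s$ not touching $v$ keeps its sign in $D_{s'}$. The number $t(S,S')$ is the number of crossings after $v$ in the chosen order that have marker $B$ in $S$. Then $\partial_{a-2,b}\circ\partial_{a,b}=0$, and the homology does not depend on the ordering of the crossings (up to isomorphism). Khovanov homology of $D$: $H_{a,b}(D)=\ker(\partial_{a,b})/\operatorname{im}(\partial_{a+2,b})$. It is an invariant of unoriented framed links (invariant under the second and third Reidemeister moves; the first move shifts the bigrading), so it is computed from the following specific diagram. Torus link: a torus link of type $(p,q)$ is a link equivalent to a curve contained in a standard torus, wrapping $p$ times around the longitude and $q$ times around the meridian; it has one component when $p$ and $q$ are relatively prime. Diagram of $T(2,n)$: the standard closure of a horizontal two-strand braid with $n$ crossings in a row, each with over-strand running from top-left to bottom-right. Thus the $A$-smoothing of one crossing gives the diagram $T(2,n-1)$ (two disjoint circles when $n=1$), the $B$-smoothing of one crossing gives a diagram of the unknot with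 $n-1$ curls (framing $1-n$), the all-$A$ state has $2$ circles and the all-$B$ state has $n$ circles. For $n=3$ it is the right-handed trefoil.
   Formalization: The entry Z at (a,b)=(-n,-3n) is asserted only for n>1; for n=1 the group there is 0, since the differential C_{1,-3}=Z → C_{-1,-3}=Z of the one-crossing unknot diagram is an isomorphism, so the printed value Z is false in that case. *)

(* Defs.v *)
(* Classical logic (boolp) is used only to make membership in the subgroup of *)
(* boundaries a boolean predicate.                                            *)
From HB Require Import structures.
From mathcomp Require Import all_boot all_order all_algebra.
From mathcomp Require Import boolp.

Set Implicit Arguments.
Unset Strict Implicit.
Unset Printing Implicit Defensive.

Import GRing.Theory Num.Theory.
Local Open Scope ring_scope.

Definition zmod_isomorphic (A B : zmodType) : Prop :=
  exists f : {additive A -> B}, bijective f.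

(* Homology at V of  U --f--> V --g--> W.  The subgroup [im_in_ker] is        *)
(* im f, viewed inside ker g (that is, its trace on ker g; when g \o f = 0,   *)
(* as for the Khovanov differential of a link diagram, it is im f itself).    *)
Section Homology.

Variables (U V W : zmodType) (f : {additive U -> V}) (g : {additive V -> W}).

Definition ker_pred : {pred V} := [pred x | g x == 0].

Fact ker_pred_zmod_closed : zmod_closed ker_pred.
Proof.
split=> [|x y]; rewrite !inE ?raddf0 // => /eqP gx /eqP gy.
by rewrite raddfB gx gy subrr.
Qed.

HB.instance Definition _ := GRing.isZmodClosed.Build V ker_pred
  ker_pred_zmod_closed.

Record ker : predArgType := Ker { ker_val :> V; _ : ker_val \in ker_pred }.

HB.instance Definition _ := [isSub for ker_val].
HB.instance Definition _ := [Choice of ker by <:].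
HB.instance Definition _ := [SubChoice_isSubZmodule of ker by <:].

Definition im_in_ker : {pred ker} := [pred x | `[< exists y : U, f y = val x >]].

Fact im_in_ker_zmod_closed : zmod_closed im_in_ker.
Proof.
split=> [|x y]; rewrite !inE; first by apply/asboolP; exists 0; rewrite !raddf0.
move=> /asboolP[x' fx] /asboolP[y' fy]; apply/asboolP; exists (x' - y').
by rewrite !raddfB fx fy.
Qed.

HB.instance Definition _ := GRing.isZmodClosed.Build ker im_in_ker
  im_in_ker_zmod_closed.

Definition homology : zmodType := Quotient.quot im_in_ker.

End Homology.

(* The four ends at a crossing: (is it at the bottom?, is it on the right?).  *)
(* Every crossing is drawn with its over-strand from TL to BR and its         *)
(* under-strand from BL to TR.                                                *)
Definition corner : finType := (bool * bool)%type.
Definition TL : corner := (false, false).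
Definition TR : corner := (false, true).
Definition BL : corner := (true, false).
Definition BR : corner := (true, true).

(* Unoriented link diagrams, as PD codes: [arc_at v c] is the arc  *)
(* of the diagram arriving at the end [c] of the crossing [v].  An arc has    *)
(* two ends, or none if it is a component without crossings.  Crossings are   *)
(* numbered, which fixes the ordering used for the signs of the differential. *)
(* Planarity plays no role in the definitions below, and is not recorded.     *)
Record link_diagram := LinkDiagram {
  ncr : nat;
  arc : finType;
  arc_at : 'I_ncr -> corner -> arc;
  _ : forall e : arc,
    #|[set p : 'I_ncr * corner | arc_at p.1 p.2 == e]| \in [:: 0; 2]%N
}.
Arguments arc_at : clear implicits.

Definition marker := bool.
Definition mA : marker := true.
Definition mB : marker := false.

(* The A-smoothing joins TL-TR and BL-BR; the B-smoothing TL-BL and TR-BR.    *)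
Definition smooth (m : marker) (c : corner) : corner :=
  if m then (c.1, ~~ c.2) else (~~ c.1, c.2).

Section Khovanov.

Variable D : link_diagram.

Local Notation crossing := 'I_(ncr D).

Definition state : finType := {ffun crossing -> marker}.

Definition joined (s : state) : rel (arc D) := fun e f =>
  [exists v : crossing, exists c : corner,
     (arc_at D v c == e) && (arc_at D v (smooth (s v) c) == f)].

(* A circle of D_s is identified with the set of arcs of D it runs through.   *)
Definition circles (s : state) : {set {set arc D}} :=
  equivalence_partition (connect (joined s)) [set: arc D].

Definition circle (s : state) : finType := {C : {set arc D} | C \in circles s}.

Definition touches (C : {set arc D}) (v : crossing) : bool :=
  [exists c : corner, arc_at D v c \in C].

(* Signs of circles: true is +, false is -. *)
Definition EKS : finType := {s : state & {ffun circle s -> bool}}.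

Definition st (S : EKS) : state := tag S.
Definition sgn (S : EKS) : {ffun circle (st S) -> bool} := tagged S.

Definition sigma (s : state) : int :=
  #|[set v | s v == mA]|%:Z - #|[set v | s v == mB]|%:Z.

Definition tau (S : EKS) : int :=
  #|[set C | sgn S C == true]|%:Z - #|[set C | sgn S C == false]|%:Z.

Definition gens (a b : int) : finType :=
  {S : EKS | (a == sigma (st S)) && (b == sigma (st S) + 2 * tau S)}.

(* The free abelian group on [gens a b]. *)
Definition chain (a b : int) : zmodType := {ffun gens a b -> int}.

(* (S, S') = 1, the marker being changed at v.  A circle of D_s not touching  *)
(* v is also a circle of D_s', with the same set of arcs.                     *)
Definition incident (v : crossing) (S S' : EKS) : bool :=
  [&& st S v == mA, st S' v == mB,
      [forall w, (w != v) ==> (st S w == st S' w)],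
      tau S' == tau S + 1
    & [forall C : circle (st S), forall C' : circle (st S'),
         (val C == val C') && ~~ touches (val C) v ==> (sgn S C == sgn S' C')]].

Definition nB_after (v : crossing) (S : EKS) : nat :=
  #|[set w : crossing | (v < w)%N && (st S w == mB)]|.

(* (-1)^t(S,S') (S,S'): the sum has at most one term. *)
Definition coeff (S S' : EKS) : int :=
  \sum_(v | incident v S S') (-1) ^+ nB_after v S.

(* The differential C_{a,b} -> C_{a',b}, used with a' = a - 2 only.  The      *)
(* degree a' is a separate parameter because a + 2 - 2 and a are not          *)
(* convertible.                                                               *)
Definition partial (a a' b : int) (x : chain a b) : chain a' b :=
  [ffun S' => \sum_S x S * coeff (val S) (val S')].

Fact partial_is_zmod_morphism a a' b : zmod_morphism (@partial a a' b).
Proof.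
move=> x y; apply/ffunP=> S'; rewrite !ffunE -sumrB.
by apply: eq_bigr => S _; rewrite !ffunE mulrBl.
Qed.

HB.instance Definition _ a a' b := GRing.isZmodMorphism.Build
  (chain a b) (chain a' b) (@partial a a' b) (@partial_is_zmod_morphism a a' b).

Definition khovanov (a b : int) : zmodType :=
  homology (@partial (a + 2) a b) (@partial a (a - 2) b).

End Khovanov.

(* The standard diagram of T(2,n), n > 0: crossings 0, ..., n - 1 from left   *)
(* to right; the arc (i, false) (resp. (i, true)) leaves the crossing i at    *)
(* its top right (resp. bottom right) end and arrives at the top left (resp.  *)
(* bottom left) end of the next crossing, cyclically.                         *)
Definition torus2_arc_at n (i : 'I_n) (c : corner) : 'I_n * bool :=
  (if c.2 then i else ord_pred i, c.1).

Fact torus2_arc_ends n (e : 'I_n * bool) :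
  #|[set p : 'I_n * corner | torus2_arc_at p.1 p.2 == e]| \in [:: 0; 2]%N.
Proof.
case: e => i t.
suff -> : [set p : 'I_n * corner | torus2_arc_at p.1 p.2 == (i, t)]
          = [set (i, (t, true)); (ordS i, (t, false))].
  by rewrite cards2 !xpair_eqE !andbF !inE.
apply/setP=> -[j [u r]]; rewrite !inE /torus2_arc_at !xpair_eqE /=.
have eqS : (ord_pred j == i) = (j == ordS i).
  exact: can2_eq (@ord_predK n) (@ordSK n) j i.
by case: r; rewrite /= ?eqS !(andbT, andbF, orbF).
Qed.

Definition torus2 (n : nat) : link_diagram :=
  LinkDiagram (@torus2_arc_ends n).

(* Main.v *)
Require Import Defs.
From mathcomp Require Import all_boot all_order all_algebra.

From HB Require Import structures.
From mathcomp Require Import zify ring boolp.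

(** In a state of the closed two-strand braid with at least one B-smoothed
    crossing, the circles are the pieces between cyclically consecutive
    B-smoothed crossings. An enhanced state is therefore a cyclic word in the
    letters A, + and -, a letter + or - being a B-smoothing with the sign of
    the circle on its left. Changing an A into a B cuts a circle in two by the
    coproduct of Z[X]/(X^2), where - is 1 and + is X. A chain is a function of
    words; in this dual form the value of the differential at a word is the
    signed sum over the ways of erasing a B, merging two circles by the
    multiplication for which + is the unit and the square of - is zero
    ([cyc_diff], [total_diff_word]).

    The words with at least one B form a complex whose homology is found by
    breaking the cyclic symmetry. The terms of the differential that do not
    merge circles across the ends of the word preserve the number of trailing
    letters A, and the remaining term changes it in one direction. For the
    former alone, the homology is concentrated on the words B^k A^(n-k), where
    it is the cokernel of the coproducts, of rank two for each k: this is
    [linear_exact], by induction on the length. Filtering by the trailing A's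
    extends it to the whole differential ([cyclic_exact]): a cycle on which two
    explicit functionals vanish, [minus_coef] and [plus_coef], is a boundary.
    So the complex has the homology of a small one with two generators, - and
    +, for each number k > 0 of B-smoothings, and the differential of the small
    complex sends the generator - of k to 1 + (-1)^k times the generator + of
    k + 1 ([plus_coef_cyc_diff]). For k > 1 this gives Z or 0 at the generator
    - and Z or Z/2 at the generator +, according to the parity of k, and Z at
    the generator - of k = n, which has no target.

    The state without B has two circles, and the map from there to k = 1 is the
    multiplication of Z[X]/(X^2). It is onto, so that nothing survives for
    k = 1, and its kernel, of rank two, is the homology for k = 0. *)

Set Implicit Arguments.
Unset Strict Implicit.
Unset Printing Implicit Defensive.

Import GRing.Theory Num.Theory.
Local Open Scope ring_scope.

(** * Homology groups as quotients of cycles *)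

Section HomologyIso.
Local Open Scope quotient_scope.
Variables (U V W G : zmodType) (f : {additive U -> V}) (g : {additive V -> W}).
Local Notation H := (homology f g).

Lemma ker0 (x : Defs.ker g) : g (val x) = 0.
Proof. by have := valP x; rewrite inE => /eqP. Qed.

Lemma pi_eq (x y : Defs.ker g) :
  \pi_H x = \pi_H y <-> exists z, f z = val x - val y.
Proof.
split=> [/eqP|[z fz]].
  by rewrite -Quotient.idealrBE inE => /asboolP[z fz]; exists z;
    rewrite fz raddfB.
apply/eqP; rewrite -Quotient.idealrBE inE; apply/asboolP.
by exists z; rewrite fz raddfB.
Qed.

Lemma homology_zero : (forall x, g x = 0 -> exists y, f y = x) ->
  forall h : H, h = 0.
Proof.
move=> ex h; rewrite -[h]reprK -[0]reprK; apply/pi_eq/ex.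
by rewrite -raddfB ker0.
Qed.

Variable phi : {additive V -> G}.
Hypothesis phi_im : forall x, g x = 0 -> phi x = 0 <-> exists y, f y = x.
Hypothesis phi_onto : forall z, exists2 x, g x = 0 & phi x = z.

Lemma phi_pi (x y : Defs.ker g) :
  phi (val x) = phi (val y) <-> \pi_H x = \pi_H y.
Proof.
rewrite pi_eq -phi_im; last by rewrite -raddfB ker0.
by split=> [E|/eqP]; [rewrite raddfB E subrr | rewrite raddfB subr_eq0 => /eqP].
Qed.

Definition homology_map (c : H) : G := phi (val (repr c)).

Lemma homology_map_pi x : homology_map (\pi_H x) = phi (val x).
Proof. by apply/phi_pi; rewrite reprK. Qed.

Fact homology_map_zmod_morphism : zmod_morphism homology_map.
Proof.
move=> c d; rewrite -[c]reprK -[d]reprK -(raddfB (\pi_H)) !homology_map_pi.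
by rewrite raddfB.
Qed.

HB.instance Definition _ :=
  GRing.isZmodMorphism.Build H G homology_map homology_map_zmod_morphism.

(** Every nonzero homology group below is computed by an additive map [phi] on
    chains whose restriction to the cycles is onto, with the boundaries as
    kernel. *)
Lemma iso_homology : zmod_isomorphic H G.
Proof.
exists homology_map.
have onto z : exists x, homology_map x == z.
  have [x gx <-] := phi_onto z.
  have kx : x \in ker_pred g by rewrite inE gx.
  by exists (\pi_H (Ker kx)); rewrite homology_map_pi.
exists (fun z => xchoose (onto z)) => [c|z]; last exact/eqP/(xchooseP (onto z)).
have /eqP := xchooseP (onto (homology_map c)).
set d := xchoose _; rewrite -[d]reprK -[c]reprK !homology_map_pi.
by move/phi_pi.
Qed.
End HomologyIso.

(** * Words and the differential on functions of words *)

(** A letter stands for a crossing: [None] if it is A-smoothed, [Some e] if it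
    is B-smoothed, where [e] is the exponent of the circle on its left, 0 for +
    and 1 for -. Exponents are not bounded, so that merging two circles, which
    adds their exponents, is a total operation. *)
Definition word := seq (option nat).
Implicit Types (w u t : word) (x y : word -> int) (e f : nat).

Definition hasB w := has isSome w.
Definition nB w := count isSome w.

(** The square of - is zero, hence so is a word with an exponent at least 2:
    chains correspond to the functions that vanish on these words. *)
Definition bad w :=
  has (fun o : option nat => if o is Some e then (1 < e)%N else false) w.

Definition kills_bad x := forall w, bad w -> x w = 0.

(** The circle that ends at the first B of [w] is merged with a circle of
    exponent [e] on its left. *)
Fixpoint absorb e w : word :=
  match w with
  | [::] => [::]
  | None :: u => None :: absorb e u
  | Some f :: u => Some (e + f)%N :: u
  end.

(** The differential acts on functions of words. Its value at a word sums over
    the letters B that can be erased, that is, over the pairs of neighbouring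
    circles that are cut from a single one. In this linear part the erased
    letter is followed by another B, and its circle is merged into the one
    ending there; the sign counts the letters B after the erased one. *)
Fixpoint lin_diff x w : int :=
  match w with
  | [::] => 0
  | None :: u => lin_diff (fun v => x (None :: v)) u
  | Some e :: u =>
      (if hasB u then (-1) ^+ nB u * x (None :: absorb e u) else 0)
      + lin_diff (fun v => x (Some e :: v)) u
  end.

Fixpoint drop_lastB w : word :=
  match w with
  | [::] => [::]
  | None :: u => None :: drop_lastB u
  | Some e :: u => if hasB u then Some e :: drop_lastB u else None :: u
  end.

Fixpoint lastB_exp w : nat :=
  match w with
  | [::] => 0%N
  | None :: u => lastB_exp u
  | Some e :: u => if hasB u then lastB_exp u else e
  end.

(** The circle that ends at the last B is followed, around the closure of the
    braid, by the circle that ends at the first B. *)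
Definition wrap_term x w : int :=
  if (1 < nB w)%N then x (absorb (lastB_exp w) (drop_lastB w)) else 0.

Definition cyc_diff x w : int := lin_diff x w + wrap_term x w.

Definition trailing_A w := find isSome (rev w).

Lemma hasB_nB w : hasB w = (0 < nB w)%N. Proof. exact: has_count. Qed.

Lemma size_absorb e w : size (absorb e w) = size w.
Proof. by elim: w => [|[f|] u IH] //=; rewrite IH. Qed.
Lemma nB_absorb e w : nB (absorb e w) = nB w.
Proof. by elim: w => [|[f|] u IH] //=; rewrite /nB /= -!/(nB _) IH. Qed.
Lemma hasB_absorb e w : hasB (absorb e w) = hasB w.
Proof. by rewrite !hasB_nB nB_absorb. Qed.
Lemma absorb0 w : absorb 0 w = w.
Proof. by elim: w => [|[f|] u IH] //=; rewrite IH. Qed.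
Lemma absorbA e f w : absorb e (absorb f w) = absorb (e + f)%N w.
Proof. by elim: w => [|[g|] u IH] //=; rewrite ?IH ?addnA. Qed.
Lemma absorb_catl e u t : hasB u -> absorb e (u ++ t) = absorb e u ++ t.
Proof. by elim: u => [|[g|] u IH] //= h; rewrite IH. Qed.
Lemma absorb_catr e u t : ~~ hasB u -> absorb e (u ++ t) = u ++ absorb e t.
Proof. by elim: u => [|[g|] u IH] //= h; rewrite IH. Qed.
Lemma bad_absorb e w : bad w -> bad (absorb e w).
Proof.
elim: w => [|[f|] u IH] //= /orP[h|->]; rewrite ?orbT //.
by apply/orP; left; lia.
Qed.
Lemma bad_absorb_big e w : hasB w -> (1 < e)%N -> bad (absorb e w).
Proof.
move=> + e2; elim: w => [|[f|] u IH] //= h.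
by rewrite (leq_trans e2) ?leq_addr.
Qed.

Lemma trailing_A_cons c w :
  trailing_A (c :: w) = if hasB w then trailing_A w
                   else if c is Some _ then size w else (size w).+1.
Proof.
rewrite /trailing_A rev_cons -cats1 find_cat has_rev -/(hasB w);
  case: ifP => //.
by rewrite size_rev; case: c => [e|] /=; rewrite ?addn0 ?addn1.
Qed.

Lemma trail_absorb e w : trailing_A (absorb e w) = trailing_A w.
Proof.
by elim: w => [|[f|] u IH] //=;
  rewrite !trailing_A_cons ?hasB_absorb ?size_absorb ?IH.
Qed.

(** [lin_diff x w] evaluates [x] only at words that come from [w] by erasing a
    B other than the last one, and these satisfy the conditions listed here. *)
Lemma eq_lin_diff_in x y w :
  (forall u, size u = size w -> hasB u -> trailing_A u = trailing_A w ->
     (nB u).+1 = nB w -> (bad w -> bad u) -> x u = y u) ->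
  lin_diff x w = lin_diff y w.
Proof.
elim: w x y => [|[e|] u IH] x y xy //=; last first.
  apply: IH => v sv hv tv nv bv; apply: xy => //=; first by rewrite sv.
  by rewrite !trailing_A_cons -!/(hasB _) hv tv hasB_nB -nv.
congr (_ + _).
  case: ifP => // hu; congr (_ * _); apply: xy => /=.
  - by rewrite size_absorb.
  - by rewrite -/(hasB _) hasB_absorb.
  - by rewrite !trailing_A_cons hasB_absorb hu trail_absorb.
  - by rewrite /nB /= -!/(nB _) nB_absorb.
  - by case/orP => [h|]; [apply: bad_absorb_big | apply: bad_absorb].
apply: IH => v sv hv tv nv bv; apply: xy => //=; first by rewrite sv.
- by rewrite !trailing_A_cons hv tv hasB_nB -nv.
- by rewrite /nB /= -!/(nB _) -nv.
- by case/orP => [->|/bv ->]; rewrite ?orbT.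
Qed.

Lemma eq_lin_diff x y w : x =1 y -> lin_diff x w = lin_diff y w.
Proof. by move=> xy; apply: eq_lin_diff_in. Qed.

Lemma lin_diff0 w : lin_diff (fun=> 0) w = 0.
Proof. by elim: w => [|[e|] u IH] //=; rewrite IH mulr0 if_same addr0. Qed.

Lemma lin_diffD x y w :
  lin_diff (fun v => x v + y v) w = lin_diff x w + lin_diff y w.
Proof.
elim: w x y => [|[e|] u IH] x y //=; rewrite ?IH //.
by case: ifP => _; ring.
Qed.
Lemma lin_diffZ c x w : lin_diff (fun v => c * x v) w = c * lin_diff x w.
Proof.
elim: w x => [|[e|] u IH] x //=; rewrite ?IH ?mulr0 //.
by case: ifP => _; ring.
Qed.
Lemma lin_diffB x y w :
  lin_diff (fun v => x v - y v) w = lin_diff x w - lin_diff y w.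
Proof.
rewrite (@eq_lin_diff _ (fun v => x v + (-1) * y v)) => [|v]; last by ring.
by rewrite lin_diffD lin_diffZ mulN1r.
Qed.

Lemma lin_diff_noB x w : ~~ hasB w -> lin_diff x w = 0.
Proof.
elim: w x => [|[e|] u IH] x //= h; exact: IH.
Qed.

Lemma lin_diff_sign x w :
  lin_diff (fun v => (-1) ^+ nB v * x v) w = - (-1) ^+ nB w * lin_diff x w.
Proof.
have [hw|hw] := boolP (hasB w); last by rewrite !lin_diff_noB ?mulr0.
rewrite -lin_diffZ; apply: eq_lin_diff_in => u _ _ _ <- _.
by rewrite exprS; ring.
Qed.

Lemma lin_diff_bad x : kills_bad x -> kills_bad (lin_diff x).
Proof.
move=> kx w bw; rewrite -(lin_diff0 w); apply: eq_lin_diff_in => u _ _ _ _ bu.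
by apply/kx/bu.
Qed.

(** Exponents add, so multiplying the first circle by a power of - commutes
    with every erasure. *)
Lemma lin_diff_absorb e x w :
  lin_diff (fun u => x (absorb e u)) w = lin_diff x (absorb e w).
Proof.
elim: w x => [|[f|] u IH] x //=; first by rewrite absorbA.
by rewrite -(IH (fun v => x (None :: v))).
Qed.

(** Two letters can be erased in either order with the same result, by
    [lin_diff_absorb]; the signs are opposite because the left letter loses one
    B after it when the right one goes first. *)
Lemma lin_diffK x w : lin_diff (lin_diff x) w = 0.
Proof.
elim: w x => [|[e|] u IH] x //=.
rewrite lin_diffD IH addr0 -(lin_diff_absorb e (fun v => x (None :: v))).
rewrite [Z in _ + Z](@eq_lin_diff_in _ (fun v => (-1) ^+ nB v * x (None ::
  absorb e v))); last first.
  by move=> v _ hv _ _ _; rewrite hv.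
rewrite (lin_diff_sign (fun v => x (None :: absorb e v))).
case: ifP => hu; first by ring.
by rewrite [lin_diff _ u]lin_diff_noB ?hu // mulr0 addr0.
Qed.

Lemma hasB_cat u t : hasB (u ++ t) = hasB u || hasB t.
Proof. exact: has_cat. Qed.
Lemma nB_cat u t : nB (u ++ t) = (nB u + nB t)%N.
Proof. exact: count_cat. Qed.
Lemma hasB_nseq j : hasB (nseq j None) = false.
Proof. by elim: j. Qed.
Lemma nB_nseq j : nB (nseq j None) = 0%N.
Proof. by elim: j. Qed.

Lemma noB_nseq w : ~~ hasB w -> w = nseq (size w) None.
Proof. by elim: w => [|[e|] u IH] //= h; rewrite -IH. Qed.

Lemma lin_diff_catN x u t :
  ~~ hasB t -> lin_diff x (u ++ t) = lin_diff (fun v => x (v ++ t)) u.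
Proof.
move=> ht; elim: u x => [|[e|] u IH] x /=; first exact: lin_diff_noB.
  rewrite IH hasB_cat nB_cat (negbTE ht) orbF; congr (_ + _);
    case: ifP => // hu.
  rewrite absorb_catl //; congr ((-1) ^+ _ * _).
  by move: ht; rewrite hasB_nB -eqn0Ngt => /eqP ->; rewrite addn0.
exact: IH.
Qed.

(** The term that merges the last B of [u] into the last B of the whole word is
    set apart: it is the one that interacts with the wrap-around term. *)
Lemma lin_diff_cat x u e t : ~~ hasB t ->
  lin_diff x (u ++ Some e :: t) =
  - lin_diff (fun v => x (v ++ Some e :: t)) u
  - (if hasB u then x (drop_lastB u ++ Some (e + lastB_exp u)%N :: t) else 0).
Proof.
move=> ht; have nt : nB t = 0%N by apply/eqP; rewrite eqn0Ngt -hasB_nB.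
elim: u x => [|[f|] u IH] x /=.
- by rewrite (negbTE ht) lin_diff_noB // oppr0 !addr0.
- rewrite hasB_cat /= orbT nB_cat /nB /= -!/(nB _) nt addn1 IH.
  have [hu|hu] := boolP (hasB u).
    by rewrite absorb_catl // exprS; ring.
  rewrite absorb_catr // !(lin_diff_noB _ hu) /= addnC.
  have -> : nB u = 0%N by apply/eqP; rewrite eqn0Ngt -hasB_nB.
  by rewrite addnC; ring.
- exact: IH.
Qed.

Lemma lastB w : hasB w -> exists u e j, w = u ++ Some e :: nseq j None.
Proof.
elim: w => [|c w IH] //= h.
have [/IH[u [e [j ->]]]|hw] := boolP (hasB w).
  by exists (c :: u), e, j.
move: h; rewrite -/(hasB w) (negbTE hw) orbF; case: c => // e _.
by exists [::], e, (size w); rewrite [in LHS](noB_nseq hw).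
Qed.

Lemma drop_lastB_cat u e j :
  drop_lastB (u ++ Some e :: nseq j None) = u ++ nseq j.+1 None.
Proof.
by elim: u => [|[f|] u IH] /=; rewrite ?hasB_nseq ?hasB_cat /= ?orbT ?IH.
Qed.
Lemma lastB_exp_cat u e j : lastB_exp (u ++ Some e :: nseq j None) = e.
Proof.
by elim: u => [|[f|] u IH] /=; rewrite ?hasB_nseq ?hasB_cat /= ?orbT ?IH.
Qed.

Lemma wrap_termE x u e j :
  wrap_term x (u ++ Some e :: nseq j None) =
  if hasB u then x (absorb e (u ++ nseq j.+1 None)) else 0.
Proof.
rewrite /wrap_term drop_lastB_cat lastB_exp_cat nB_cat /nB /= -!/(nB _) nB_nseq
  hasB_nB.
by rewrite addn1 ltnS.
Qed.

Lemma wrap_term_noB x w : ~~ hasB w -> wrap_term x w = 0.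
Proof. by rewrite /wrap_term hasB_nB; case: (nB w). Qed.

Lemma cyc_diff_noB x w : ~~ hasB w -> cyc_diff x w = 0.
Proof. by move=> h; rewrite /cyc_diff wrap_term_noB // lin_diff_noB. Qed.

(** Wrapping the last circle around anticommutes with the erasures among the
    other letters, by [lin_diff_absorb]. Wrapping the last two circles around,
    one after the other, gives the same word as merging the last but one into
    the last and wrapping the result around, with the opposite sign. *)
Lemma cyc_diffK x w : cyc_diff (cyc_diff x) w = 0.
Proof.
have [hw|hw] := boolP (hasB w); last by rewrite cyc_diff_noB.
have [u [e [j ->]]] := lastB hw.
rewrite /cyc_diff lin_diffD lin_diffK add0r wrap_termE lin_diff_cat
  ?hasB_nseq //.
rewrite (@eq_lin_diff_in _ (fun v => x (absorb e (v ++ nseq j.+1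
  None)))) => [|v _ hv _ _ _]; last first.
  by rewrite /= wrap_termE hv.
have [hu|hu] := boolP (hasB u); last by rewrite [lin_diff _ u]lin_diff_noB //;
  ring.
rewrite -(lin_diff_absorb e x) lin_diff_catN ?(hasB_nseq j.+1) //.
set D := lin_diff _ u; rewrite wrap_termE.
have [u1 [f [i eu]]] := lastB hu.
rewrite {}eu drop_lastB_cat lastB_exp_cat.
have -> : absorb e ((u1 ++ Some f :: nseq i None) ++ nseq j.+1 None)
        = absorb e (u1 ++ Some f :: nseq (i + j.+1) None).
  by rewrite -catA /= nseqD.
have [h1|h1] := boolP (hasB u1).
  rewrite [absorb e (u1 ++ Some f :: _)]absorb_catl // wrap_termE hasB_absorb
    h1.
  rewrite -absorb_catl // absorbA hasB_cat h1 /= -catA -(nseqD i.+1 j.+1).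
  by rewrite [in absorb _ _]addnC; ring.
rewrite [absorb e (u1 ++ Some f :: _)]absorb_catr //= wrap_termE hasB_cat
  (negbTE h1).
by rewrite (hasB_nseq i.+1) /=; ring.
Qed.

(** * The two coefficient maps *)

Definition minuses k : word := nseq k (Some 1%N).

(** On the words B^k t the linear part of the differential consists of the
    coproducts of Z[X]/(X^2) at neighbouring circles. In its cokernel a word
    with two circles + vanishes, and a single + can move to a neighbour at the
    cost of a sign: the cokernel has rank two. The coefficient of its generator
    with all circles - is [minus_coef]; the coefficient of the other one is
    [plus_coef], the alternating sum over the positions of the circle +. *)
Definition minus_coef k t x : int := x (minuses k ++ t).

Fixpoint plus_coef k t x : int :=
  if k is l.+1 then
    x (Some 0%N :: minuses l ++ t) - plus_coef l t (fun v => x (Some 1%N :: v))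
  else 0.

Lemma nB_minuses k : nB (minuses k) = k.
Proof. by rewrite /nB count_nseq mul1n. Qed.
Lemma hasB_minuses k : hasB (minuses k) = (0 < k)%N.
Proof. by rewrite hasB_nB nB_minuses. Qed.

Lemma eq_plus_coef k t t' x y :
  (forall u, size u = k -> all isSome u -> x (u ++ t) = y (u ++ t')) ->
  plus_coef k t x = plus_coef k t' y.
Proof.
elim: k x y => [|k IH] x y xy //=; congr (_ - _).
  apply: (xy (Some 0%N :: minuses k)); rewrite /= ?size_nseq //.
  by rewrite all_nseq orbT.
by apply: IH => u su au; apply: (xy (Some 1%N :: u)); rewrite /= ?su.
Qed.

Lemma plus_coef0 k t : plus_coef k t (fun=> 0) = 0.
Proof. by elim: k => [|k IH] //=; rewrite IH subr0. Qed.
Lemma plus_coefD k t x y :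
  plus_coef k t (fun v => x v + y v) = plus_coef k t x + plus_coef k t y.
Proof. by elim: k x y => [|k IH] x y //=; rewrite IH; ring. Qed.
Lemma plus_coefZ k t c x :
  plus_coef k t (fun v => c * x v) = c * plus_coef k t x.
Proof. by elim: k x => [|k IH] x //=; rewrite ?IH; ring. Qed.
Lemma plus_coefB k t x y :
  plus_coef k t (fun v => x v - y v) = plus_coef k t x - plus_coef k t y.
Proof. by elim: k x y => [|k IH] x y //=; rewrite IH; ring. Qed.

Lemma kills_cons c x : kills_bad x -> kills_bad (fun v => x (c :: v)).
Proof. by move=> kx w bw; apply: kx; rewrite /= bw orbT. Qed.

Lemma bad_absorb1_minuses k t : (0 < k)%N -> bad (absorb 1 (minuses k ++ t)).
Proof. by case: k. Qed.

Lemma plus_coef_absorb1 k t x : kills_bad x -> (0 < k)%N ->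
  plus_coef k t (fun v => x (absorb 1 v)) = x (minuses k ++ t).
Proof.
move=> kx; case: k => // k _ /=; rewrite -[RHS]subr0; congr (_ - _).
by rewrite -(plus_coef0 k t); apply: eq_plus_coef => u _ _; apply: kx.
Qed.

Lemma minus_coef_lin_diff k t x :
  kills_bad x -> ~~ hasB t -> minus_coef k t (lin_diff x) = 0.
Proof.
rewrite /minus_coef => kx ht; elim: k x kx => [|k IH] x kx;
  first exact: lin_diff_noB.
rewrite /= IH ?addr0; last exact: kills_cons.
case: ifP => //; rewrite hasB_cat (negbTE ht) orbF hasB_minuses => k0.
by rewrite kx ?mulr0 //; apply: bad_absorb1_minuses.
Qed.

(** A word with one A among k - 1 letters - is reached by erasing a letter + or
    the letter before a +; these two positions of the + are neighbours and have
    opposite signs. *)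
Lemma plus_coef_lin_diff k t x :
  kills_bad x -> ~~ hasB t -> plus_coef k t (lin_diff x) = 0.
Proof.
move=> kx ht; elim: k x kx => [|k IH] x kx //=.
rewrite -/(minus_coef k t (lin_diff _)) minus_coef_lin_diff ?addr0 //;
  last exact: kills_cons.
rewrite plus_coefD IH ?addr0; last exact: kills_cons.
rewrite hasB_cat (negbTE ht) orbF hasB_minuses.
have nt : nB t = 0%N by apply/eqP; rewrite eqn0Ngt -hasB_nB.
case: k IH => [|k] IH; first by rewrite subr0.
rewrite (@eq_plus_coef _ _ t _ (fun u => (-1) ^+ k.+1 * x (None :: absorb 1
  u))) => [|u su au].
  rewrite plus_coefZ (@plus_coef_absorb1 _ _ (fun v => x (None :: v))) //;
    last exact: kills_cons.
  by rewrite nB_cat nB_minuses nt addn0 absorb0 subrr.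
have nu : nB u = k.+1 by move: au; rewrite all_count su => /eqP.
by rewrite hasB_cat hasB_nB nu nB_cat nu nt addn0.
Qed.

Lemma plus_coefS k t x : plus_coef k.+1 t x =
  x (Some 0%N :: minuses k ++ t) - plus_coef k t (fun v => x (Some 1%N :: v)).
Proof. by []. Qed.

Lemma plus_coef_rcons k t x :
  plus_coef k.+1 t x =
  plus_coef k (Some 1%N :: t) x + (-1) ^+ k * x (minuses k ++ Some 0%N :: t).
Proof.
elim: k x => [|k IH] x; first by rewrite /=; ring.
rewrite (plus_coefS k.+1) IH (plus_coefS k) exprS.
have -> : minuses k ++ Some 1%N :: t = minuses k.+1 ++ t.
  by rewrite -cat1s catA -(nseqD k 1) addn1.
by rewrite /=; ring.
Qed.

Lemma minus_coef_wrap k j x :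
  kills_bad x -> minus_coef k (nseq j None) (wrap_term x) = 0.
Proof.
rewrite /minus_coef => kx; case: k => [|k];
  first by rewrite wrap_term_noB // hasB_nseq.
have -> : minuses k.+1 =
  minuses k ++ [:: Some 1%N] by rewrite -(nseqD k 1) addn1.
rewrite -catA wrap_termE hasB_minuses; case: ifP => // k0.
by rewrite kx //; apply: bad_absorb1_minuses.
Qed.

Lemma minus_coef_cyc_diff k j x :
  kills_bad x -> minus_coef k (nseq j None) (cyc_diff x) = 0.
Proof.
move=> kx; rewrite /minus_coef /cyc_diff -!/(minus_coef k _ _).
by rewrite minus_coef_lin_diff ?minus_coef_wrap ?hasB_nseq // addr0.
Qed.

(** Only the wrap-around term contributes, and only at the words whose + comes
    first or last; both turn into the word with all circles -, with the signs 1
    and (-1)^(k+1) of the alternating sum. The factor 2 is the source of the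
    torsion. *)
Lemma plus_coef_cyc_diff k j x : kills_bad x ->
  plus_coef k.+2 (nseq j None) (cyc_diff x) =
  (1 + (-1) ^+ k.+1) * minus_coef k.+1 (nseq j.+1 None) x.
Proof.
move=> kx; rewrite plus_coefD plus_coef_lin_diff ?hasB_nseq // add0r
  plus_coef_rcons wrap_termE hasB_minuses absorb0.
have -> : plus_coef k.+1 (Some 1%N :: nseq j None) (wrap_term x)
        = plus_coef k.+1 (nseq j.+1 None) (fun v => x (absorb 1 v)).
  apply: eq_plus_coef => u su au; rewrite wrap_termE hasB_nB.
  by move: au; rewrite all_count su -/(nB u) => /eqP ->.
by rewrite plus_coef_absorb1 // /minus_coef; ring.
Qed.

(** * Exactness *)

(** Induction on the length. The coproduct followed by the projection of its
    first factor to + is bijective, so the values of a cycle on words starting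
    with A are determined by those on words starting with +, and both are
    removed at once by a primitive supported on the words starting with A. What
    is left is supported on the words starting with -, a copy of the complex of
    shorter words. The primitive vanishes on the words B^k A^j, so that
    subtracting it changes neither coefficient map. *)
Lemma linear_exact n x : kills_bad x ->
  (forall w, size w = n -> lin_diff x w = 0) ->
  (forall k j, (k + j)%N = n -> (0 < k)%N ->
     minus_coef k (nseq j None) x = 0 /\ plus_coef k (nseq j None) x = 0) ->
  exists y, [/\ kills_bad y,
    forall u j, all isSome u -> y (u ++ nseq j None) = 0
    & forall w, size w = n -> hasB w -> lin_diff y w = x w].
Proof.
elim: n x => [|n IH] x kx cx px.
  by exists (fun=> 0); split => // -[|[e|] u].
pose b w : int := (-1) ^+ nB w.
have b2 w : b w * b w = 1 by rewrite /b -expr2 sqrr_sign.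
pose x0 u := x (Some 0%N :: u); pose x1 u := x (Some 1%N :: u).
have kx0 : kills_bad x0 by apply: kills_cons.
have kx1 : kills_bad x1 by apply: kills_cons.
pose g u := x1 u - x0 (absorb 1 u).
have kg : kills_bad g.
  by move=> w bw; rewrite /g kx1 // kx0 ?subrr //; apply: bad_absorb.
have [||d [kd td Hd]] := IH g kg.
- move=> w sw; have [hw|hw] := boolP (hasB w); last by rewrite lin_diff_noB.
  rewrite lin_diffB (lin_diff_absorb 1 x0).
  have := cx (Some 1%N :: w); have := cx (Some 0%N :: absorb 1 w).
  rewrite /= size_absorb sw hasB_absorb hw nB_absorb => /(_ erefl) E0 /(_
    erefl) E1.
  move: E0 E1; rewrite absorb0 -/x0 -/x1 => E0 E1.
  apply/eqP; rewrite subr_eq0; apply/eqP.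
  by apply: (addrI ((-1) ^+ nB w * x (None :: absorb 1 w))); rewrite E0 E1.
- move=> k j kj k0; have [||p1 pX] := px k.+1 j; rewrite ?addSn ?kj //.
  have := p1; rewrite /minus_coef /= -/(x1 _) => p1'.
  split; first by rewrite /minus_coef /g p1' kx0 ?subrr //;
    apply: bad_absorb1_minuses.
  by rewrite plus_coefB (plus_coef_absorb1 _ kx0) // -opprB -plus_coefS pX
    oppr0.
(* the words starting with A remove those starting with +; [d] comes from the
   complex of shorter words *)
exists (fun v => match v with
  | None :: u => if hasB u then b u * x0 u else 0
  | Some 1%N :: u => d u
  | _ => 0 end).
split.
- move=> [|[[|[|e]]|] u] //= bw; first exact: kd.
  by rewrite kx0 // mulr0 if_same.
- move=> [|c u] j /=; first by case: j => // j; rewrite /= hasB_nseq.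
  by case: c => [[|[|e]]|] //=; exact: td.
move=> [|c u] //= [su] hu.
have [hBu|hBu] := boolP (hasB u); last first.
  rewrite lin_diff_noB //.
  have px1 := px 1%N n erefl erefl.
  have {hu} : isSome c || hasB u := hu; rewrite (negbTE hBu) orbF.
  case: c => // e _; rewrite lin_diff_noB // addr0.
  rewrite (noB_nseq hBu) su; have [q1 q2] := px1.
  move: q2; rewrite /= subr0 => q2.
  by case: e => [|[|e]] //; rewrite kx //.
case: c hu => [e|] hu; last first.
  rewrite (@eq_lin_diff_in _ (fun v => b v * x0 v)) => [|v _ hv _ _ _];
    last by rewrite hv.
  rewrite lin_diff_sign -/(b u) mulNr.
  have := cx (Some 0%N :: u);
    rewrite /= su hBu absorb0 -/(b u) -/x0 => /(_ erefl) E.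
  have -> : lin_diff x0 u = - (b u * x (None :: u)) by apply/eqP;
    rewrite -addr_eq0 addrC E.
  by rewrite mulrN opprK mulrA b2 mul1r.
rewrite hasB_absorb hBu {1}/b nB_absorb mulrA -/(b u) b2 mul1r.
case: e hu => [|[|e]] hu.
- by rewrite lin_diff0 addr0 absorb0.
- by rewrite (eq_lin_diff (y := d)) // Hd // /g addrC subrK.
- rewrite lin_diff0 addr0 kx0 ?kx //.
  exact: bad_absorb_big.
Qed.

Lemma wrap_termD x y w :
  wrap_term (fun v => x v + y v) w = wrap_term x w + wrap_term y w.
Proof. by rewrite /wrap_term; case: ifP => //; rewrite addr0. Qed.
Lemma wrap_termZ c x w : wrap_term (fun v => c * x v) w = c * wrap_term x w.
Proof. by rewrite /wrap_term; case: ifP => //; rewrite mulr0. Qed.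
Lemma cyc_diffD x y w :
  cyc_diff (fun v => x v + y v) w = cyc_diff x w + cyc_diff y w.
Proof. by rewrite /cyc_diff lin_diffD wrap_termD; ring. Qed.
Lemma cyc_diffZ c x w : cyc_diff (fun v => c * x v) w = c * cyc_diff x w.
Proof. by rewrite /cyc_diff lin_diffZ wrap_termZ; ring. Qed.
Lemma eq_cyc_diff x y w : x =1 y -> cyc_diff x w = cyc_diff y w.
Proof. by move=> xy; rewrite /cyc_diff (eq_lin_diff _ xy) /wrap_term;
  case: ifP => // _; rewrite xy. Qed.
Lemma cyc_diffB x y w :
  cyc_diff (fun v => x v - y v) w = cyc_diff x w - cyc_diff y w.
Proof.
rewrite (@eq_cyc_diff _ (fun v => x v + (-1) * y v)) => [|v]; last by ring.
by rewrite cyc_diffD cyc_diffZ mulN1r.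
Qed.
Lemma cyc_diff0 w : cyc_diff (fun=> 0) w = 0.
Proof. by rewrite /cyc_diff lin_diff0 /wrap_term if_same. Qed.

Lemma bad_cat u t : bad (u ++ t) = bad u || bad t.
Proof. exact: has_cat. Qed.
Lemma bad_nseq j : bad (nseq j None) = false.
Proof. by elim: j. Qed.

Lemma cyc_diff_bad x : kills_bad x -> kills_bad (cyc_diff x).
Proof.
move=> kx w bw; rewrite /cyc_diff lin_diff_bad // add0r.
have [hw|hw] := boolP (hasB w); last exact: wrap_term_noB.
have [u [e [j ew]]] := lastB hw; move: bw;
  rewrite {}ew bad_cat /= -/(bad _) wrap_termE.
rewrite bad_nseq orbF => bw; case: ifP => // hu; apply: kx.
case/orP: bw => [bu|e2]; first by apply: bad_absorb; rewrite bad_cat bu.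
by apply: bad_absorb_big => //; rewrite hasB_cat hu.
Qed.

Lemma trailing_A_cat u e j : trailing_A (u ++ Some e :: nseq j None) = j.
Proof.
rewrite /trailing_A rev_cat rev_cons rev_nseq -cats1 find_cat has_cat has_nseq
  andbF /=.
by rewrite find_cat has_nseq andbF /= size_nseq addn0.
Qed.

Lemma trailing_A_top u j : (0 < size u)%N -> all isSome u ->
  trailing_A (u ++ nseq j None) = j.
Proof.
case: (lastP u) => // v [e|] _; rewrite all_rcons //= => _.
by rewrite cat_rcons trailing_A_cat.
Qed.

Lemma trailing_A_lt w : hasB w -> (trailing_A w < size w)%N.
Proof.
move/lastB=> [u [e [j ->]]]; rewrite trailing_A_cat size_cat /= size_nseq; lia.
Qed.

Lemma lin_diff_trailing m x w :
  lin_diff (fun v => if trailing_A v == m then x v else 0) w =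
  if trailing_A w == m then lin_diff x w else 0.
Proof.
case: ifP => h.
  by apply: eq_lin_diff_in => u _ _ -> _ _; rewrite h.
by rewrite -[RHS](lin_diff0 w); apply: eq_lin_diff_in => u _ _ -> _ _;
  rewrite h.
Qed.

Lemma wrap_term_trailing m x w :
  (forall u, size u = size w -> hasB u -> (m < trailing_A u)%N -> x u = 0) ->
  (m <= trailing_A w)%N -> wrap_term x w = 0.
Proof.
have [hw|hw] := boolP (hasB w); last by rewrite wrap_term_noB.
have [u [e [j ->]]] := lastB hw; rewrite trailing_A_cat => x0 mj.
rewrite wrap_termE; case: ifP => // hu; apply: x0.
- by rewrite size_absorb !size_cat.
- by rewrite hasB_absorb hasB_cat hu.
- have [u1 [f [i ->]]] := lastB hu.
  by rewrite trail_absorb -catA cat_cons -nseqD trailing_A_cat; lia.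
Qed.

Lemma plus_coef_top0 k t x :
  (forall u, all isSome u -> x (u ++ t) = 0) -> plus_coef k t x = 0.
Proof. by move=> h; rewrite -(plus_coef0 k t);
  apply: eq_plus_coef => u _ /h. Qed.

(** The number of trailing letters A is preserved by the linear part of the
    differential, and the wrap-around term evaluates functions at words with
    more of them. Hence [linear_exact] applies to the values of [x] on the
    words with the most trailing A's on which it does not vanish; subtracting
    the boundary obtained leaves a cycle supported on words with fewer trailing
    A's. *)
Lemma cyclic_exact n x : kills_bad x ->
  (forall w, size w = n -> cyc_diff x w = 0) ->
  (forall k j, (k + j)%N = n -> (0 < k)%N ->
     minus_coef k (nseq j None) x = 0 /\ plus_coef k (nseq j None) x = 0) ->
  exists y, [/\ kills_bad y,
    forall u j, all isSome u -> y (u ++ nseq j None) = 0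
    & forall w, size w = n -> hasB w -> cyc_diff y w = x w].
Proof.
suff H m : forall x, kills_bad x ->
  (forall w, size w = n -> cyc_diff x w = 0) ->
  (forall k j, (k + j)%N = n -> (0 < k)%N ->
     minus_coef k (nseq j None) x = 0 /\ plus_coef k (nseq j None) x = 0) ->
  (forall w, size w = n -> hasB w -> (m <= trailing_A w)%N -> x w = 0) ->
  exists y, [/\ kills_bad y,
    forall u j, all isSome u -> y (u ++ nseq j None) = 0
    & forall w, size w = n -> hasB w -> cyc_diff y w = x w].
  move=> kx cx px; apply: (H n) => // w <- hw.
  by rewrite leqNgt trailing_A_lt.
elim: m => [|m IH] {}x kx cx px vx.
  by exists (fun=> 0); split => // w sw hw; rewrite cyc_diff0 vx.
pose xm w := if trailing_A w == m then x w else 0.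
have kxm : kills_bad xm by move=> w bw; rewrite /xm kx // if_same.
have [w sw|k j kj k0|y [ky ty Hy]] := linear_exact (n := n) kxm.
- rewrite lin_diff_trailing; case: eqP => // tw.
  have := cx w sw; rewrite /cyc_diff (@wrap_term_trailing m) ?tw ?addr0 // => u
    su hu mu.
  by apply: vx; rewrite ?su.
- have [p1 pX] := px k j kj k0; split.
    by rewrite /minus_coef /xm; case: ifP => // _; exact: p1.
  have top u : size u = k -> all isSome u -> trailing_A (u ++ nseq j None) = j.
    by move=> su au; rewrite trailing_A_top ?su.
  have [jm|jm] := eqVneq j m.
    rewrite -pX; apply: eq_plus_coef => u su au.
    by rewrite /xm top // jm eqxx.
  rewrite -(plus_coef0 k (nseq j None)); apply: eq_plus_coef => u su au.
  by rewrite /xm top // (negbTE jm).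
pose ym w := if trailing_A w == m then y w else 0.
have kym : kills_bad ym by move=> w bw; rewrite /ym ky // if_same.
have tym u j : all isSome u -> ym (u ++ nseq j None) = 0.
  by move=> au; rewrite /ym ty // if_same.
have dym w : size w = n -> hasB w -> lin_diff ym w = xm w.
  move=> sw hw; rewrite lin_diff_trailing /xm; case: eqP => // tw.
  by rewrite Hy // /xm tw eqxx.
have eym w : (m <= trailing_A w)%N -> wrap_term ym w = 0.
  move=> mw; apply: (@wrap_term_trailing m) => // u _ _ mu.
  by rewrite /ym gtn_eqF.
have [w bw|w sw|k j kj k0|w sw hw mw|y' [ky' ty' Hy']] :=
    IH (fun w => x w - cyc_diff ym w).
- by rewrite kx // cyc_diff_bad // subrr.
- by rewrite cyc_diffB cx // cyc_diffK subrr.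
- have [p1 pX] := px k j kj k0; split.
    by rewrite /minus_coef -!/(minus_coef k _ _) p1 minus_coef_cyc_diff //
      subrr.
  rewrite plus_coefB pX sub0r; case: k k0 {kj p1 pX} => [|[|k]] // _;
    last first.
    by rewrite plus_coef_cyc_diff // /minus_coef tym ?mulr0 ?oppr0 // all_nseq
      orbT.
  rewrite /= /cyc_diff /= hasB_nseq lin_diff_noB ?hasB_nseq // /wrap_term /nB
    /= -/(nB _) nB_nseq /=.
  by rewrite !subr0.
- have [tw|tw] := eqVneq (trailing_A w) m.
    by rewrite /cyc_diff dym // eym // /xm tw eqxx addr0 subrr.
  have -> : x w = 0 by apply: vx => //; rewrite ltn_neqAle eq_sym tw.
  by rewrite /cyc_diff dym // eym // /xm (negbTE tw).
exists (fun w => y' w + ym w); split.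
- by move=> w bw; rewrite ky' // kym.
- by move=> u j au; rewrite ty' // tym.
- by move=> w sw hw; rewrite cyc_diffD Hy' // subrK.
Qed.

(** * Circles of the smoothings of the closed two-strand braid *)

Definition next_true (b : seq bool) (k : nat) : nat :=
  if has id (drop k b) then (k + find id (drop k b))%N else find id b.

(** Moving to the right around the closed braid, every crossing reaches one
    that satisfies [B]. *)
Lemma cyclic_ind n (P B : 'I_n -> Prop) :
  (forall v, B v -> P v) -> (forall v, P (ordS v) -> P v) ->
  (exists v, B v) -> forall v, P v.
Proof.
move=> PB PS [v0 /PB Pv0] v.
(* the number of steps to the right from [v] to [v0] *)
pose d (v : 'I_n) := (if v <= v0 then v0 - v else v0 + n - v)%N.
have [k] : exists k, d v = k by exists (d v).
elim: k v => [|k IH] v dv.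
  suff -> : v = v0 by [].
  apply: val_inj => /=; move: dv (ltn_ord v); rewrite /d; case: ifP => ?; lia.
apply: PS; apply: IH; move: dv (ltn_ord v) (ltn_ord v0); rewrite /d /=.
have [lt|ge] := ltnP v.+1 n.
  rewrite modn_small //; case: ifP; case: ifP; lia.
move=> dv ? ?; have -> : v.+1 = n by apply/eqP; rewrite eqn_leq ge andbT.
rewrite modnn leq0n; move: dv; case: ifP; lia.
Qed.

Section Torus.
Variable n : nat.
Local Notation D := (torus2 n).
Implicit Types (s : state D) (v q : 'I_n) (S : EKS D).

Definition marks s : seq bool := [seq (s v == mB) | v : 'I_n].
Definition hasBs s := [exists v : 'I_n, s v == mB].
Definition nextB s (v : nat) := next_true (marks s) v.

Lemma size_marks s : size (marks s) = n.
Proof. by rewrite size_map -cardE card_ord. Qed.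

Lemma nth_marks s v : nth false (marks s) v = (s v == mB).
Proof. by rewrite (nth_map v) ?size_enum_ord // nth_ord_enum. Qed.

Lemma has_marks s : has id (marks s) = hasBs s.
Proof.
rewrite has_map; apply/hasP/existsP => [[v _ h]|[v h]]; exists v => //.
by rewrite mem_enum.
Qed.

Lemma drop_marks s v : drop v (marks s) = (s v == mB) :: drop v.+1 (marks s).
Proof. by rewrite (drop_nth false) ?size_marks // nth_marks. Qed.

Lemma nextB_ordS s v : nextB s (ordS v) = nextB s v.+1.
Proof.
rewrite /nextB /next_true /=; have [lt|ge] := ltnP v.+1 n;
  first by rewrite modn_small.
have -> : v.+1 = n by apply/eqP; rewrite eqn_leq ge andbT.
rewrite modnn drop0 [drop n _]drop_oversize ?size_marks //=.
by rewrite add0n if_same.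
Qed.

Lemma nextB_rec s v :
  nextB s v = if s v == mB then v : nat else nextB s (ordS v).
Proof.
rewrite nextB_ordS /nextB /next_true drop_marks /=; case: (s v == mB);
  rewrite /= ?addn0 //.
by rewrite addnS addSn.
Qed.

Lemma nextBP s v : hasBs s -> exists2 q : 'I_n, s q == mB & nextB s v = q.
Proof.
move=> /existsP h; move: v.
apply: (cyclic_ind (B := fun v => s v == mB)) => // [v sv|v IH].
  by exists v => //; rewrite nextB_rec sv.
rewrite nextB_rec; case: ifP => // sv; by exists v.
Qed.

(** A complete invariant of the circle through an arc: the first B to the right
    of the arc or, when there is none, the strand, top or bottom. *)
Definition circle_key s (a : Defs.arc D) : nat :=
  if hasBs s then nextB s (ordS a.1) else a.2.

Lemma joined_key s (a b : Defs.arc D) :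
  joined s a b -> circle_key s a = circle_key s b.
Proof.
case/existsP=> v /existsP[[c1 c2]] /andP[/eqP<- /eqP<-] {a b}.
rewrite /circle_key /= /torus2_arc_at /smooth; case sv: (s v) => /=; last first.
  by have -> : hasBs s by apply/existsP; exists v; rewrite sv.
case: ifP => // hs.
have E : nextB s (ordS (ord_pred v)) = nextB s (ordS v).
  by rewrite ord_predK nextB_rec sv.
by case: c2.
Qed.

Lemma connect_key s (a b : Defs.arc D) :
  connect (joined s) a b -> circle_key s a = circle_key s b.
Proof.
case/connectP=> p; elim: p a => [|c p IH] a /=; first by move=> _ ->.
by case/andP=> /joined_key -> /IH h /h.
Qed.

Lemma joined_sym s : symmetric (joined s).
Proof.
suff H a b : joined s a b -> joined s b a by move=> a b; apply/idP/idP;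
  apply: H.
case/existsP=> v /existsP[c /andP[/eqP<- /eqP<-]].
apply/existsP; exists v; apply/existsP; exists (smooth (s v) c).
by rewrite eqxx /= /smooth; case: (s v); case: c => [[] []].
Qed.

Lemma joined_A s v (t : bool) : s v = mA -> joined s (ord_pred v, t) (v, t).
Proof.
move=> sv; apply/existsP; exists v; apply/existsP; exists (t, false).
by rewrite sv /= /torus2_arc_at /= !eqxx.
Qed.

Lemma joined_B s v (t : bool) :
  s v = mB -> joined s (ord_pred v, t) (ord_pred v, ~~ t).
Proof.
move=> sv; apply/existsP; exists v; apply/existsP; exists (t, false).
by rewrite sv /= /torus2_arc_at /= !eqxx.
Qed.

Lemma connect_nextB s v q (t : bool) : hasBs s -> nextB s v = q ->
  connect (joined s) (ord_pred v, t) (ord_pred q, false).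
Proof.
move=> /existsP h; move: v.
apply: (cyclic_ind (B := fun v => s v == mB)) => // [v|v IH].
  move=> sv; rewrite nextB_rec sv => /val_inj <-; case: t; last exact: connect0.
  by apply/connect1/joined_B/eqP.
rewrite nextB_rec; case: ifP => [sv|sv].
  move=> /val_inj <-; case: t {IH}; last exact: connect0.
  by apply/connect1/joined_B/eqP.
move/IH; rewrite ordSK; apply: connect_trans; apply/connect1/joined_A.
by move: sv; case: (s v).
Qed.

(** Along A-smoothed crossings an arc is joined to the arcs on its right, up to
    those just left of the next B, which are joined to each other there. *)
Lemma connectE s (a b : Defs.arc D) :
  connect (joined s) a b = (circle_key s a == circle_key s b).
Proof.
apply/idP/eqP => [|]; first exact: connect_key.
case: a b => [i t] [j t']; rewrite /circle_key; case: ifP => hs.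
  move=> E0; have {E0} E : nextB s (ordS i) = nextB s (ordS j) := E0;
    have [q _ Eq] := nextBP (ordS i) hs.
  have Ci := connect_nextB t hs Eq; rewrite E in Eq.
  have Cj := connect_nextB t' hs Eq; rewrite !ordSK in Ci Cj.
  by apply: connect_trans Ci _; rewrite (sym_connect_sym (@joined_sym s)).
have stateA v : s v = mA.
  by move/existsPn: hs => /(_ v); case: (s v).
move=> tt'; have <- : t = t' by case: t tt'; case: t'.
pose P (v : 'I_n) := connect (joined s) (v, t) (j, t).
apply: (@cyclic_ind n P (fun v => v = j)) => [_ ->|v IH|];
  [exact: connect0| |by exists j].
apply: connect_trans IH; apply: connect1.
by have := joined_A t (stateA (ordS v)); rewrite ordSK.
Qed.

Fact circle_of_subproof s (a : Defs.arc D) :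
  [set b | connect (joined s) a b] \in circles s.
Proof.
by apply/imsetP; exists a => //; apply/setP => b; rewrite !inE.
Qed.

Definition circle_of s (a : Defs.arc D) : circle s :=
  exist (fun C : {set Defs.arc D} => C \in circles s) _ (circle_of_subproof s
    a).

Lemma mem_circle_of s (a b : Defs.arc D) :
  (b \in val (circle_of s a)) = (circle_key s a == circle_key s b).
Proof. by rewrite inE connectE. Qed.

Lemma circle_of_eq s (a b : Defs.arc D) :
  circle_key s a = circle_key s b -> circle_of s a = circle_of s b.
Proof. by move=> E; apply/val_inj/setP => c; rewrite !mem_circle_of E. Qed.

Lemma circle_ofP s (C : circle s) : exists a, C = circle_of s a.
Proof.
case: C => C hC; have /imsetP[a _ Ca] := hC; exists a; apply: val_inj => /=.
by rewrite Ca; apply/setP => b; rewrite !inE.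
Qed.

Definition circle_to s v : circle s := circle_of s (ord_pred v, false).

Lemma circle_key_pred s v (t : bool) :
  hasBs s -> s v = mB -> circle_key s (ord_pred v, t) = v.
Proof.
move=> hs sv; have E : nextB s (ordS (ord_pred v)) = v.
  by rewrite ord_predK nextB_rec sv eqxx.
by rewrite /circle_key hs; exact: E.
Qed.

Lemma circle_toP s (C : circle s) :
  hasBs s -> exists2 q : 'I_n, s q = mB & C = circle_to s q.
Proof.
move=> hs; have [a ->] := circle_ofP C.
have [q /eqP sq Eq] := nextBP (ordS a.1) hs; exists q => //.
by apply: circle_of_eq; rewrite circle_key_pred // /circle_key hs.
Qed.

Lemma circle_to_inj s :
  hasBs s -> {in [set v | s v == mB] &, injective (circle_to s)}.
Proof.
move=> hs v q; rewrite !inE => /eqP sv /eqP sq E.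
apply: val_inj => /=; rewrite -(circle_key_pred false hs sv) -(circle_key_pred
  false hs sq).
by apply/eqP; rewrite -mem_circle_of [circle_of _ _]E mem_circle_of.
Qed.

Lemma sum_circle s (F : circle s -> int) : hasBs s ->
  \sum_C F C = \sum_(v : 'I_n | s v == mB) F (circle_to s v).
Proof.
move=> hs;
transitivity (\sum_(v in [set v : 'I_n | s v == mB]) F (circle_to s v)).
  rewrite -(big_imset F (circle_to_inj hs)) /=.
  apply: eq_bigl => C; apply/esym/imsetP.
  by have [q sq ->] := circle_toP C hs; exists q; rewrite // inE sq.
by apply: eq_bigl => v; rewrite inE.
Qed.

(** * Enhanced states as words *)

Definition label S v : option nat :=
  if st S v == mB then Some (~~ sgn S (circle_to (st S) v) : nat) else None.

Definition word_of S : word := [seq label S v | v : 'I_n].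

Lemma size_word_of S : size (word_of S) = n.
Proof. by rewrite size_map -cardE card_ord. Qed.

Lemma nth_word_of S v : nth None (word_of S) v = label S v.
Proof. by rewrite (nth_map v) ?size_enum_ord // nth_ord_enum. Qed.

Lemma isSome_label S v : isSome (label S v) = (st S v == mB).
Proof. by rewrite /label; case: ifP. Qed.

Lemma marks_word_of S : map isSome (word_of S) = marks (st S).
Proof. by rewrite -map_comp; apply: eq_map => v /=; rewrite isSome_label. Qed.

Lemma hasB_word_of S : hasB (word_of S) = hasBs (st S).
Proof. by rewrite -has_marks -marks_word_of has_map. Qed.

Lemma word_of_good S : ~~ bad (word_of S).
Proof.
rewrite /bad -all_predC; apply/allP => o /mapP[v _ ->] /=; rewrite /label.
by case: ifP => // _; case: (sgn S _).
Qed.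

Lemma eq_word w1 w2 : size w1 = n -> size w2 = n ->
  (forall v, nth None w1 v = nth None w2 v) -> w1 = w2.
Proof.
move=> s1 s2 E; apply: (@eq_from_nth _ None); rewrite ?s1 ?s2 // => i ni.
exact: (E (Ordinal ni)).
Qed.

Definition tauw w : int :=
  \sum_(o <- w) (if o is Some e then 1 - 2 * e%:Z else 0).

Lemma tau_sum S : tau S = \sum_C (if sgn S C then 1 else -1).
Proof.
rewrite (bigID (fun C => sgn S C == true)) /= /tau; congr (_ + _).
  under eq_bigr => C /eqP -> do [].
  by rewrite sumr_const cardsE -natz.
rewrite (eq_bigr (fun=> -1)) => [|C]; last by case: (sgn S C).
rewrite sumr_const mulNrn -natz; congr (- _%:R); rewrite cardsE.
by apply: eq_card => C; rewrite !unfold_in; case: (sgn S C).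
Qed.

Lemma tau_word_of S : hasBs (st S) -> tau S = tauw (word_of S).
Proof.
move=> hs; rewrite tau_sum sum_circle // /tauw big_map big_enum /= big_mkcond.
by apply: eq_bigr => v _; rewrite /label; case: ifP => // _; case: (sgn S _).
Qed.

Lemma word_of_inj S1 S2 : hasBs (st S1) -> word_of S1 = word_of S2 -> S1 = S2.
Proof.
move=> hs E.
have E' v : label S1 v = label S2 v by rewrite -!nth_word_of E.
have Es : st S1 = st S2.
  apply/ffunP => v; have := isSome_label S1 v; rewrite E' isSome_label.
  by case: (st S1 v); case: (st S2 v).
case: S1 S2 E' hs Es {E} => [s1 g1] [s2 g2] E hs; rewrite /st /= => Es.
subst s2; congr existT; apply/ffunP => C.
have [q sq ->] := circle_toP C hs.
have := E q; rewrite /label /= sq eqxx => -[]; rewrite /sgn /=.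
by case: (g1 _); case: (g2 _).
Qed.

Lemma word_of_surj w :
  size w = n -> hasB w -> ~~ bad w -> exists S, word_of S = w.
Proof.
move=> sw hw gw.
pose s : state D := [ffun v : 'I_n => if nth None w v is Some _ then mB else
  mA].
have sE v : (s v == mB) = isSome (nth None w v).
  by rewrite ffunE; case: (nth None w v).
pose g : {ffun circle s -> bool} :=
  [ffun C : circle s => [exists a in val C,
    nth None w (circle_key s a) == Some 0%N]].
have hs : hasBs s.
  have /(has_nthP None)[i si Pi] := hw.
  by apply/existsP; rewrite sw in si; exists (Ordinal si); rewrite sE.
exists (existT _ s g : EKS D).
apply: eq_word => // [|v]; first exact: size_word_of.
rewrite nth_word_of /label /st /= sE; case E: (nth None w v) => [e|] //=.
have sv : s v = mB by apply/eqP; rewrite sE E.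
rewrite /sgn /= ffunE; congr Some.
have -> : [exists a in val (circle_to s v),
  nth None w (circle_key s a) == Some 0%N] = (e == 0)%N.
  apply/exists_inP/eqP => [[a]|e0].
    by rewrite mem_circle_of circle_key_pred // => /eqP <- /eqP;
      rewrite E => -[].
  by exists (ord_pred v, false);
    rewrite ?mem_circle_of // circle_key_pred // E e0.
have : ~~ (1 < e)%N.
  move: gw; rewrite /bad -all_predC => /(all_nthP None)/(_ v).
  by rewrite sw ltn_ord /= E => /(_ isT).
by case: e {E} => [|[|e]].
Qed.
End Torus.

(** * Erasing a letter and incidence of enhanced states *)

Definition erase w i : word :=
  let e := odflt 0%N (nth None w i) in
  if hasB (drop i.+1 w) then take i w ++ None :: absorb e (drop i.+1 w)
  else absorb e (take i w ++ None :: drop i.+1 w).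

Definition next_index w k := next_true (map isSome w) k.

Lemma lin_diff_sum x w : lin_diff x w =
  \sum_(i < size w | nth None w i && hasB (drop i.+1 w))
     (-1) ^+ nB (drop i.+1 w) * x (erase w i).
Proof.
elim: w x => [|c u IH] x; first by rewrite big_ord0.
rewrite big_mkcond big_ord_recl -big_mkcond /= drop0.
under eq_bigl => i do rewrite add0n.
transitivity ((if c && hasB u then (-1) ^+ nB u * x (erase (c :: u) 0) else 0)
   + lin_diff (fun v => x (c :: v)) u).
  case: c => [e|] /=; last by rewrite add0r.
  by congr (_ + _); rewrite /erase /= drop0; case: ifP.
congr (_ + _); rewrite IH; apply: eq_big => // i /andP[_ h].
by rewrite /erase /= h.
Qed.

Lemma drop_cat1 u c t : drop (size u).+1 (u ++ c :: t) = t.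
Proof. by rewrite -cat_rcons drop_size_cat ?size_rcons. Qed.

Lemma wrap_term_sum x w : (1 < nB w)%N -> wrap_term x w =
  \sum_(i < size w | nth None w i && ~~ hasB (drop i.+1 w)) x (erase w i).
Proof.
move=> nw; have hw : hasB w by rewrite hasB_nB; lia.
have [u [e [j ew]]] := lastB hw.
have iu : (size u < size w)%N by rewrite ew size_cat /=; lia.
have hu : hasB u by move: nw;
  rewrite ew nB_cat /nB /= -!/(nB _) nB_nseq hasB_nB; lia.
rewrite (big_pred1 (Ordinal iu)) => [|i] /=.
  rewrite ew wrap_termE hu /erase nth_cat ltnn subnn /= take_size_cat //.
  by rewrite drop_cat1 hasB_nseq.
rewrite -val_eqE /=; move: (nat_of_ord i) => {}i; rewrite ew nth_cat.
have [lt|gt|->] := ltngtP i (size u).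
- rewrite drop_cat; have [lt'|ge] := ltnP i.+1 (size u).
    by rewrite hasB_cat /= orbT andbF.
  have -> : (i.+1 - size u)%N = 0%N by lia.
  by rewrite drop0 /= andbF.
- case E : (i - size u)%N => [|k]; first by lia.
  by rewrite /= nth_nseq if_same.
by rewrite subnn drop_cat1 hasB_nseq.
Qed.

Lemma cyc_diff_sum x w : (1 < nB w)%N -> cyc_diff x w =
  \sum_(i < size w | nth None w i) (-1) ^+ nB (drop i.+1 w) * x (erase w i).
Proof.
move=> nw; rewrite [RHS](bigID (fun i : 'I__ => hasB (drop i.+1 w))) /=
  /cyc_diff.
rewrite lin_diff_sum wrap_term_sum //; congr (_ + _);
  apply: eq_bigr => i /andP[_].
by rewrite hasB_nB; case: nB => // _; rewrite mul1r.
Qed.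

Lemma size_erase w i : (i < size w)%N -> size (erase w i) = size w.
Proof.
move=> iw; rewrite /erase; case: ifP => _;
  rewrite ?size_absorb size_cat /= ?size_absorb;
  rewrite size_take size_drop iw; lia.
Qed.

Lemma nth_absorb e w j :
  nth None (absorb e w) j =
  if hasB w && (j == find isSome w)
  then Some (e + odflt 0%N (nth None w j))%N else nth None w j.
Proof.
elim: w j => [|[f|] u IH] [|j] //=; rewrite ?andbF // IH.
Qed.

Lemma nth_erase w i j : (i < size w)%N -> nth None w i -> (1 < nB w)%N ->
  nth None (erase w i) j =
  if j == i then None
  else if j == next_index w i.+1
  then Some (odflt 0%N (nth None w i) + odflt 0%N (nth None w j))%N
  else nth None w j.
Proof.
move=> iw wi nw; rewrite /next_index /next_true -map_drop has_map /= find_map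
  -/(hasB _).
have ew : w = take i w ++ nth None w i :: drop i.+1 w.
  by rewrite -drop_nth // cat_take_drop.
move: wi nw iw; rewrite /erase; set c := nth None w i in ew *.
move: ew; set p := take i w; set q := drop i.+1 w => ew.
case: c ew => // e ew _ nw iw.
have sp : size p = i by rewrite size_takel // ltnW.
rewrite find_map [in RHS]ew.
have [hq|hq] := boolP (hasB q).
  rewrite !nth_cat sp; have [lt|gt|->] := ltngtP j i; last by rewrite subnn.
    by case: eqP => // ?; lia.
  case E : (j - i)%N => [|k] /=; first by lia.
  rewrite nth_absorb hq /=; have -> : j = (i.+1 + k)%N by lia.
  by rewrite (eqn_add2l i.+1).
have hp : hasB p.
  move: hq nw; rewrite ew nB_cat /nB /= -!/(nB _) !hasB_nB; lia.
rewrite absorb_catl // !nth_cat size_absorb sp.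
have fp : (find isSome p < i)%N by rewrite -sp -has_find.
rewrite find_cat -/(hasB p) hp nth_absorb hp /=.
have [lt|gt|->] := ltngtP j i => //; last by rewrite subnn.
case: eqP => [ej|_]; first by have : (find (preim isSome id) p < i)%N := fp;
  lia.
by case E : (j - i)%N => [|k] //=; lia.
Qed.

Lemma tauw_erase w i : (i < size w)%N -> nth None w i -> (1 < nB w)%N ->
  tauw (erase w i) = tauw w - 1.
Proof.
pose tt (o : option nat) : int := if o is Some e then 1 - 2 * e%:Z else 0.
have tauE w' : tauw w' = \sum_(o <- w') tt o by [].
have tau_absorb e u : hasB u -> tauw (absorb e u) = tauw u - 2 * e%:Z.
  rewrite !tauE; elim: u => [|[f|] u IH] //= h; rewrite !big_cons /=.
    by rewrite PoszD; ring.
  by rewrite IH // addrA.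
move=> iw wi nw.
have ew : w = take i w ++ nth None w i :: drop i.+1 w.
  by rewrite -drop_nth // cat_take_drop.
move: wi nw; rewrite [in tauw w]ew /erase; move: ew.
case: (nth None w i) => // e ew _; move: ew.
set p := take i w; set q := drop i.+1 w => ew nw.
have [hq|hq] := boolP (hasB q).
  rewrite !tauE !big_cat !big_cons /= -!tauE tau_absorb //; ring.
have hp : hasB p.
  move: hq nw; rewrite ew nB_cat /nB /= -!/(nB _) !hasB_nB; lia.
rewrite tau_absorb ?hasB_cat ?hp // !tauE !big_cat !big_cons /=; ring.
Qed.

Section Torus.
Variable n : nat.
Local Notation D := (torus2 n).
Implicit Types (s : state D) (v q : 'I_n) (S : EKS D).

(** Passing from [s'] to [s] merges the circle on the left of [v] with the
    circle on the left of [p], the next B of [s']; the other circles stay the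
    same. *)
Section Change.
Variables (s s' : state D) (v : 'I_n).
Hypotheses (sv : s v = mA) (s'v : s' v = mB).
Hypothesis ss' : forall q, q != v -> s q = s' q.
Hypothesis hs : hasBs s.

Let p := nextB s' (ordS v).

Lemma nextB_change (q : 'I_n) :
  nextB s q = if nextB s' q == v then p else nextB s' q.
Proof.
have /existsP h := hs; move: q.
apply: (cyclic_ind (B := fun v => s v == mB)) => // [q sq|q IH].
  have qv : q != v by apply: contraTneq sq => ->; rewrite sv.
  by rewrite nextB_rec [nextB s' q]nextB_rec sq -ss' // sq val_eqE (negbTE qv).
case: (eqVneq q v) IH => [->|qv] IH.
  by rewrite [LHS]nextB_rec sv [nextB s' v]nextB_rec s'v !eqxx IH if_same.
rewrite nextB_rec [nextB s' q]nextB_rec -ss' //; case: ifP => // sq.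
by rewrite val_eqE (negbTE qv).
Qed.

Lemma nextB_v : nextB s v = p.
Proof. by rewrite nextB_change [nextB s' v]nextB_rec s'v !eqxx. Qed.

Lemma target_B : exists2 q : 'I_n, s q = mB & p = q.
Proof. by have [q /eqP sq] := nextBP v hs; rewrite nextB_v; exists q. Qed.

Lemma hasBs' : hasBs s'.
Proof. by apply/existsP; exists v; rewrite s'v. Qed.

Lemma other_circle q : s q = mB -> p != q :> nat ->
  (val (circle_to s q) == val (circle_to s' q)) &&
  ~~ touches (val (circle_to s q)) v.
Proof.
move=> sq pq; have hs' := hasBs'.
have qv : q != v by apply: contra_eq_neq sq => ->; rewrite sv.
have s'q : s' q = mB by rewrite -ss'.
apply/andP; split.
  apply/eqP/setP => a; rewrite !mem_circle_of !circle_key_pred // /circle_key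
    hs hs'.
  rewrite nextB_change; case: ifP => // /eqP ->.
  by rewrite eq_sym (negbTE pq) val_eqE (negbTE qv).
apply/existsPn => -[c1 c2];
  rewrite mem_circle_of circle_key_pred // /circle_key hs /torus2_arc_at.
have E : nextB s (ordS (if c2 then v else ord_pred v)) = p.
  by case: c2; rewrite ?ord_predK -?nextB_v // [RHS]nextB_rec sv.
by rewrite eq_sym [Z in Z == _]E.
Qed.

Lemma other_circleP (C : circle s) (C' : circle s') :
  (val C == val C') && ~~ touches (val C) v ->
  exists2 q : 'I_n, [/\ s q = mB, q != v & p != q :> nat]
                  & C = circle_to s q /\ C' = circle_to s' q.
Proof.
have hs' := hasBs'; case/andP=> /eqP CC' tC.
have [q sq eC] := circle_toP C hs; have [q' s'q' eC'] := circle_toP C' hs'.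
have qv : q != v by apply: contra_eq_neq sq => ->; rewrite sv.
have s'q : s' q = mB by rewrite -ss'.
have qq' : q' = q.
  have : (ord_pred q, false) \in val C by rewrite eC mem_circle_of.
  rewrite CC' eC' mem_circle_of !circle_key_pred // => /eqP; exact: val_inj.
exists q; last by rewrite eC eC' qq'.
split=> //; apply: contraNneq tC => pq; apply/existsP; exists TR.
rewrite eC mem_circle_of circle_key_pred // /circle_key hs -pq -nextB_v [nextB
  s v]nextB_rec sv /torus2_arc_at.
exact: eqxx.
Qed.

End Change.

Lemma incident_markers v S S' : @incident D v S S' ->
  [/\ st S v = mA, st S' v = mB & forall q, q != v -> st S q = st S' q].
Proof.
case/and5P=> /eqP -> /eqP -> /forallP h _ _; split=> // q qv.
by have := h q; rewrite qv => /eqP.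
Qed.

Lemma nB_word_of S : nB (word_of S) = #|[set v : 'I_n | st S v == mB]|.
Proof.
rewrite /nB -[LHS]sum1_count big_map big_enum_cond -sum1_card.
by apply: eq_bigl => v; rewrite isSome_label inE.
Qed.

Lemma next_index_word_of S v :
  next_index (word_of S) v.+1 = nextB (st S) (ordS v).
Proof. by rewrite nextB_ordS /next_index marks_word_of. Qed.

Lemma erase_markers v S S' : (1 < nB (word_of S'))%N -> st S' v = mB ->
  word_of S = erase (word_of S') v ->
  [/\ st S v = mA, st S' v = mB & forall q, q != v -> st S q = st S' q].
Proof.
move=> nS' s'v E.
have hs' : hasBs (st S') by apply/existsP; exists v; rewrite s'v.
have L (q : 'I_n) : (st S q == mB) = if q == v then false else st S' q == mB.
  rewrite -isSome_label -nth_word_of E nth_erase ?size_word_of ?nth_word_of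
    ?isSome_label ?s'v // val_eqE.
  case: eqP => // qv; rewrite -[st S' q == _]isSome_label next_index_word_of;
    case: eqP => //.
  have [p sp ->] := nextBP (ordS v) hs' => /val_inj ->.
  by rewrite isSome_label sp.
split=> // [|q qv].
  by have := L v; rewrite eqxx; case: (st S v).
by have := L q; rewrite (negbTE qv); case: (st S q); case: (st S' q).
Qed.

Lemma tauw_nth w : size w = n ->
  tauw w = \sum_(q < n) (if nth None w q is Some e then 1 - 2 * e%:Z else 0).
Proof. by move=> sw; rewrite /tauw (big_nth None) sw big_mkord. Qed.

(** The circles other than those ending at [v] and at its successor keep their
    signs, and the value of tau then forces the exponents of these two to add
    up to that of the circle they are cut from. *)
Lemma incident_erase v S S' : (1 < nB (word_of S'))%N -> st S' v = mB ->
  @incident D v S S' = hasBs (st S) && (word_of S == erase (word_of S') v).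
Proof.
move=> nS' s'v.
have hs' : hasBs (st S') by apply/existsP; exists v; rewrite s'v.
have vw : (v < size (word_of S'))%N by rewrite size_word_of.
have Bv : isSome (nth None (word_of S') v) by rewrite nth_word_of isSome_label
  s'v.
apply/idP/andP => [inc|[hs /eqP E]].
  have [sv _ ss'] := incident_markers inc.
  have hs : hasBs (st S).
    move: nS'; rewrite nB_word_of (cardsD1 v) inE s'v add1n
      ltnS => /card_gt0P[q].
    by rewrite !inE => /andP[qv sq]; apply/existsP; exists q; rewrite ss'.
  split=> //; apply/eqP.
  have [p sp Ep] := target_B sv s'v ss' hs.
  have agree q : q != p ->
      nth None (word_of S) q = nth None (erase (word_of S') v) q.
    move=> qp; rewrite nth_erase // !nth_word_of next_index_word_of Ep !val_eqE
      (negbTE qp).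
    have [->|qv] := eqVneq q v; first by rewrite /label sv.
    rewrite /label ss' //; case: eqP => // sq;
      congr (Some (nat_of_bool (~~ _))).
    have sq' : st S q = mB by rewrite ss'.
    have pq : nextB (st S') (ordS v) != q by rewrite Ep val_eqE eq_sym.
    case/and5P: inc => _ _ _ _ /forallP/(_ (circle_to (st S) q))/forallP/(_
      (circle_to (st S') q)).
    by rewrite (other_circle sv s'v ss' hs sq' pq) => /eqP.
  apply: eq_word => [||q]; rewrite ?size_erase ?size_word_of //.
  have [->|] := eqVneq q p; last exact: agree.
  have : tauw (word_of S) = tauw (erase (word_of S') v).
    rewrite tauw_erase // -!tau_word_of //.
    by case/and5P: inc => _ _ _ /eqP -> _; rewrite addrK.
  rewrite !tauw_nth ?size_erase ?size_word_of // (bigD1 p) //= [RHS](bigD1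
    p) //=.
  rewrite [Z in _ + Z = _ -> _](eq_bigr (fun q : 'I_n =>
     if nth None (erase (word_of S') v) q is Some e then 1 - 2 * e%:Z else
       0)) => [|k kp]; last first.
    by rewrite agree.
  move/addIr; rewrite nth_word_of nth_erase // next_index_word_of Ep eqxx.
  have pv : p != v by apply: contra_eq_neq sp => ->; rewrite sv.
  rewrite val_eqE (negbTE pv) /label sp eqxx; move: (~~ _ : nat) => k.
  by move=> h; congr Some; lia.
have [sv _ ss'] := erase_markers nS' s'v E.
apply/and5P; split; rewrite ?sv ?s'v //.
- by apply/forallP => q; apply/implyP => /ss' ->.
- by rewrite !tau_word_of // E tauw_erase // subrK.
apply/forallP => C; apply/forallP => C'; apply/implyP.
case/(other_circleP sv s'v ss' hs) => q [sq qv pq] [-> ->].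
have : label S q = label S' q.
  by rewrite -!nth_word_of E nth_erase // next_index_word_of val_eqE (negbTE
    qv) eq_sym (negbTE pq).
have inj (c d : bool) : Some (~~ c : nat) = Some (~~ d : nat) -> c == d.
  by case: c; case: d.
by rewrite /label sq -ss' // sq eqxx => /inj.
Qed.
End Torus.

(** * Chains as functions of words *)

Section Graded.
Variable D : link_diagram.
Implicit Types (S : EKS D) (a b : int) (z : EKS D -> int).

Definition deg a b S :=
  (a == sigma (st S)) && (b == sigma (st S) + 2 * tau S).

(** Chains are viewed as functions on all enhanced states, zero outside their
    bidegree, on which the differential has no degree to keep track of. *)
Definition extend a b (c : chain D a b) S : int := oapp c 0 (insub S).

Definition restrict a b z : chain D a b := [ffun g => z (val g)].

Definition total_diff z S' : int := \sum_S z S * coeff S S'.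

Lemma extend_val a b (c : chain D a b) g : extend c (val g) = c g.
Proof. by rewrite /extend valK. Qed.

Lemma extend_deg a b (c : chain D a b) S : extend c S != 0 -> deg a b S.
Proof. by rewrite /extend; case: insubP => //=; rewrite eqxx. Qed.

Lemma extend_restrict a b z S : deg a b S -> extend (restrict a b z) S = z S.
Proof. by move=> h; rewrite /extend insubT /= ffunE. Qed.

Lemma extendD a b (c c' : chain D a b) S :
  extend (c + c') S = extend c S + extend c' S.
Proof. by rewrite /extend; case: insub => //= g; rewrite ffunE. Qed.

Lemma extend0 a b S : extend (0 : chain D a b) S = 0.
Proof. by rewrite /extend; case: insub => //= g; rewrite ffunE. Qed.

Lemma sigma_card (s : state D) :
  sigma s = (ncr D)%:Z - 2 * #|[set v | s v == mB]|%:Z.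
Proof.
rewrite /sigma; have := cardsC [set v | s v == mA]; rewrite card_ord.
have -> : ~: [set v | s v == mA] = [set v | s v == mB].
  by apply/setP => v; rewrite !inE; case: (s v).
move=> h; set p := #|_| in h *; set q := #|_| in h *; lia.
Qed.

Lemma coeff_deg S S' a b : coeff S S' != 0 -> deg a b S = deg (a - 2) b S'.
Proof.
move=> c0; have [v inc] : exists v, incident v S S'.
  apply/existsP; apply: contraNT c0 => /existsPn h.
  by rewrite /coeff big_pred0 // => v; apply/negbTE/h.
case/and5P: inc => /eqP sv /eqP s'v /forallP ss' /eqP tt _.
rewrite /deg tt.
have -> : sigma (st S') = sigma (st S) - 2.
  rewrite !sigma_card (cardsD1 v [set _ | st S' _ == _]) inE s'v.
  have -> : [set u | st S' u == mB] :\ v = [set u | st S u == mB].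
    apply/setP => u; rewrite !inE; have := ss' u; have [->|uv] := eqVneq u v.
      by rewrite sv.
    by move=> /eqP ->.
  rewrite eqxx add1n; set p := #|_|; lia.
by apply/andP/andP => -[/eqP h1 /eqP h2]; split; apply/eqP; lia.
Qed.

Lemma partialE a a' b (c : chain D a b) g :
  @partial D a a' b c g = total_diff (extend c) (val g).
Proof.
rewrite ffunE /total_diff;
  transitivity (\sum_(S in deg a b | true) extend c S * coeff S (val g)).
  by rewrite big_sub_cond; apply: eq_bigr => h _; rewrite extend_val.
rewrite [RHS](bigID (deg a b)) /= [Z in _ = _ + Z]big1 => [|S hS].
  by rewrite addr0; apply: eq_bigl => S; rewrite andbT.
by have [->|/extend_deg] := eqVneq (extend c S) 0; rewrite ?mul0r ?(negbTE hS).
Qed.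

Lemma extend_partial a b (c : chain D a b) S' :
  extend (@partial D a (a - 2) b c) S' = total_diff (extend c) S'.
Proof.
have [h|h] := boolP (deg (a - 2) b S'); last first.
  have /eqP -> : extend (@partial D a (a - 2) b c) S' == 0.
    by apply: contraNT h => /extend_deg.
  rewrite /total_diff big1 // => S _; apply/eqP;
    rewrite mulf_eq0 -[_ || _]negbK negb_or.
  by apply/negP => /andP[/extend_deg h1 /coeff_deg h2]; rewrite -h2 h1 in h.
by rewrite {1}/extend insubT /= partialE.
Qed.

Lemma total_diff_restrict a b z S' :
  deg (a - 2) b S' -> total_diff (extend (restrict a b z)) S' = total_diff z S'.
Proof.
move=> h; apply: eq_bigr => S _.
have [->|/coeff_deg c] := eqVneq (coeff S S') 0; first by rewrite !mulr0.
by congr (_ * _); apply: extend_restrict; rewrite c.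
Qed.

Lemma total_diffE z S' : total_diff z S' =
  \sum_v \sum_(S | incident v S S') (-1) ^+ nB_after v S * z S.
Proof.
rewrite /total_diff; under eq_bigr => S _ do rewrite mulr_sumr.
rewrite (exchange_big_dep xpredT) //=; apply: eq_bigr => v _.
by apply: eq_bigr => S _; rewrite mulrC.
Qed.

End Graded.

Lemma cyc_diff_le1 x w : (nB w <= 1)%N -> cyc_diff x w = 0.
Proof.
have [/lastB[u [e [j ->]]]|hw] := boolP (hasB w); last by rewrite cyc_diff_noB.
rewrite nB_cat /nB /= -!/(nB _) nB_nseq => h.
have hu : ~~ hasB u by rewrite hasB_nB; lia.
by rewrite /cyc_diff lin_diff_cat ?hasB_nseq // wrap_termE (negbTE hu)
  lin_diff_noB //; ring.
Qed.

Lemma eq_wrap_term_in x y w :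
  (forall u, size u = size w -> hasB u -> x u = y u) ->
    wrap_term x w = wrap_term y w.
Proof.
have [/lastB[u [e [j ->]]]|hw] := boolP (hasB w);
  last by rewrite !wrap_term_noB.
move=> E; rewrite !wrap_termE; case: ifP => // hu; apply: E.
  by rewrite size_absorb !size_cat.
by rewrite hasB_absorb hasB_cat hu.
Qed.

Lemma eq_cyc_diff_in x y w :
  (forall u, size u = size w -> hasB u -> x u = y u) ->
    cyc_diff x w = cyc_diff y w.
Proof.
by move=> E; rewrite /cyc_diff (eq_wrap_term_in E); congr (_ + _);
  apply: eq_lin_diff_in => *; apply: E.
Qed.

Section Torus.
Variable n : nat.
Local Notation D := (torus2 n).
Implicit Types (s : state D) (v q : 'I_n) (S : EKS D) (a b : int).

(** The sum has at most one term, by [word_of_inj]. *)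
Definition word_fun (z : EKS D -> int) w : int :=
  \sum_(S | hasBs (st S) && (word_of S == w)) z S.

Lemma eq_word_fun z z' : z =1 z' -> word_fun z =1 word_fun z'.
Proof. by move=> E w; apply: eq_bigr => S _. Qed.

Lemma word_fun_word_of z S : hasBs (st S) -> word_fun z (word_of S) = z S.
Proof.
move=> hs; rewrite /word_fun (big_pred1 S) // => S' /=.
apply/andP/eqP => [[hs' /eqP]|->]; [exact: word_of_inj | by rewrite hs].
Qed.

Lemma word_fun_bad z : kills_bad (word_fun z).
Proof.
move=> w bw; rewrite /word_fun big_pred0 // => S; apply/andP => -[_ /eqP E].
by move: (word_of_good S); rewrite E bw.
Qed.

Lemma nB_after_word_of v S : nB_after (D := D) v S = nB (drop v.+1 (word_of S)).
Proof.
rewrite /nB -[in RHS](@take_size _ (drop _ _)) size_drop size_word_of.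
rewrite -(@map_nth_iota _ None); last by rewrite size_word_of.
rewrite count_map -sum1_count /= -[iota _ _]/(index_iota v.+1 n) big_geq_mkord.
rewrite /nB_after -sum1_card; apply: eq_bigl => q;
  rewrite !inE nth_word_of isSome_label.
by rewrite andbC.
Qed.

Lemma total_diff_word z S' : (1 < nB (word_of S'))%N ->
  total_diff z S' = cyc_diff (word_fun z) (word_of S').
Proof.
move=> nS'; rewrite total_diffE cyc_diff_sum // -(big_mkord (fun i => nth None
  (word_of S') i : bool)
  (fun i => (-1) ^+ nB (drop i.+1 (word_of S')) * word_fun z (erase (word_of
    S') i))).
rewrite size_word_of big_mkord [RHS]big_mkcond; apply: eq_bigr => v _.
rewrite nth_word_of isSome_label; case: eqP => s'v; last first.
  by rewrite big_pred0 // => S; apply/negP => /incident_markers[].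
rewrite /word_fun mulr_sumr.
rewrite (eq_bigl _ _ (fun S => incident_erase S nS' s'v)).
apply: eq_bigr => S /andP[_ /eqP ewS]; congr ((-1) ^+ _ * _).
have [_ _ ss'] := erase_markers nS' s'v ewS.
rewrite -nB_after_word_of; apply: eq_card => q; rewrite !inE.
by case: ltnP => //= vq; rewrite ss' // -val_eqE /= gtn_eqF.
Qed.

Lemma sigma_word_of S : sigma (st S) = n%:Z - 2 * (nB (word_of S))%:Z.
Proof. by rewrite sigma_card nB_word_of. Qed.

Section Chains.
Variables a b : int.
Implicit Types c : chain D a b.

Definition chain_fun c : word -> int := word_fun (extend c).

Lemma chain_funD c c' w : chain_fun (c + c') w = chain_fun c w + chain_fun c' w.
Proof. by rewrite /chain_fun (eq_word_fun (extendD c c')) /word_fun big_split.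
  Qed.

Lemma chain_fun0 w : chain_fun 0 w = 0.
Proof. by rewrite /chain_fun (eq_word_fun (@extend0 D a b)) /word_fun big1. Qed.

Lemma chain_funB c c' w : chain_fun (c - c') w = chain_fun c w - chain_fun c' w.
Proof. by apply/eqP; rewrite eq_sym subr_eq -chain_funD subrK. Qed.

Lemma chain_fun_bad c : kills_bad (chain_fun c).
Proof. exact: word_fun_bad. Qed.

Lemma gens_sigma (g : gens D a b) : a = n%:Z - 2 * (nB (word_of (val g)))%:Z.
Proof. by case: g => S /= /andP[/eqP -> _]; rewrite sigma_word_of. Qed.

Lemma deg_word_of S : hasBs (st S) ->
  a = n%:Z - 2 * (nB (word_of S))%:Z -> b = a + 2 * tauw (word_of S) ->
    deg a b S.
Proof.
by move=> hs ea eb; rewrite /deg sigma_word_of -ea eqxx tau_word_of // eb eqxx.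
Qed.

Lemma chain_fun_supp c w : chain_fun c w != 0 ->
  [/\ size w = n, hasB w, a = n%:Z - 2 * (nB w)%:Z & b = a + 2 * tauw w].
Proof.
move=> h; have [S /andP[hs /eqP <-] zS] : exists2 S,
  hasBs (st S) && (word_of S == w) & extend c S != 0.
  apply/exists_inP; apply: contraNT h => /exists_inPn h; apply/eqP/big1 => S /h.
  by rewrite negbK => /eqP.
have /andP[/eqP ea /eqP eb] := extend_deg zS.
rewrite size_word_of hasB_word_of; split=> //;
  first by rewrite ea sigma_word_of.
by rewrite eb -tau_word_of // -ea.
Qed.

Lemma chain_fun_val c g :
  hasBs (st (val g)) -> chain_fun c (word_of (val g)) = c g.
Proof. by move=> hs; rewrite /chain_fun word_fun_word_of // extend_val. Qed.

Definition chain_of (Y : word -> int) : chain D a b :=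
  restrict a b (fun S => if hasBs (st S) then Y (word_of S) else 0).

Lemma chain_fun_chain_of Y w : kills_bad Y -> size w = n -> hasB w ->
  a = n%:Z - 2 * (nB w)%:Z -> b = a + 2 * tauw w ->
    chain_fun (chain_of Y) w = Y w.
Proof.
move=> kY sw hw ea eb; have [bw|gw] := boolP (bad w).
  by rewrite kY // chain_fun_bad.
have [S eS] := word_of_surj sw hw gw; rewrite -eS in hw ea eb *.
rewrite hasB_word_of in hw.
by rewrite /chain_fun word_fun_word_of // extend_restrict ?hw //;
  apply: deg_word_of.
Qed.

Lemma partial_chain_of a' (e' : a' = a - 2) Y (g : gens D a' b) : kills_bad Y ->
  (1 < nB (word_of (val g)))%N ->
    @partial D a a' b (chain_of Y) g = cyc_diff Y (word_of (val g)).
Proof.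
move: g; rewrite {}e' => g kY ng;
  rewrite partialE (total_diff_restrict _ (valP g)) total_diff_word //.
apply: eq_cyc_diff_in => w; rewrite size_word_of => sw hw.
have [bw|gw] := boolP (bad w); first by rewrite kY // word_fun_bad.
have [S eS] := word_of_surj sw hw gw; rewrite -eS in hw *;
  rewrite hasB_word_of in hw.
by rewrite word_fun_word_of // hw.
Qed.

End Chains.

Lemma chain_fun_partial a b a' (e' : a' = a - 2) (c : chain D a b) w :
  size w = n -> (1 < nB w)%N ->
  chain_fun (@partial D a a' b c) w = cyc_diff (chain_fun c) w.
Proof.
rewrite {}e' => sw nw; have hw : hasB w by rewrite hasB_nB; lia.
have [bw|gw] := boolP (bad w).
  by rewrite cyc_diff_bad ?chain_fun_bad //; apply: chain_fun_bad.
have [S eS] := word_of_surj sw hw gw; rewrite -eS in hw nw *;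
  rewrite hasB_word_of in hw.
by rewrite /chain_fun word_fun_word_of // extend_partial total_diff_word.
Qed.

Lemma cyc_diff_cycle a b (c : chain D a b) : @partial D a (a - 2) b c = 0 ->
  forall w, size w = n -> cyc_diff (chain_fun c) w = 0.
Proof.
move=> c0 w sw; have [nw|nw] := ltnP 1 (nB w); last exact: cyc_diff_le1.
by rewrite -(chain_fun_partial (erefl _)) // c0 chain_fun0.
Qed.

End Torus.

(** * Degrees with at least two B-smoothings *)

Lemma tauw_cat u t : tauw (u ++ t) = tauw u + tauw t.
Proof. exact: big_cat. Qed.
Lemma tauw_nseq j : tauw (nseq j None) = 0.
Proof. by rewrite /tauw big_nseq; elim: j => //= j ->. Qed.
Lemma tauw_cons (c : option nat) u :
  tauw (c :: u) = (if c is Some e then 1 - 2 * e%:Z else 0) + tauw u.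
Proof. exact: big_cons. Qed.
Lemma tauw_minuses k : tauw (minuses k) = - k%:Z.
Proof.
elim: k => [|k IH]; first by rewrite /tauw big_nil.
by rewrite tauw_cons IH; lia.
Qed.
Lemma all_minuses k : all isSome (minuses k).
Proof. by rewrite all_nseq orbT. Qed.
Lemma nB_all u : all isSome u -> nB u = size u.
Proof. by rewrite all_count => /eqP. Qed.

Lemma plus_coef_tauw k t x :
  (forall u, size u = k -> all isSome u -> tauw u = 2 - k%:Z -> x (u ++ t) = 0)
    ->
  plus_coef k t x = 0.
Proof.
elim: k x => [|k IH] x h //=; rewrite (h (Some 0%N :: minuses k)) ?IH ?subrr //.
- move=> u su au tu; apply: (h (Some 1%N :: u)) => //=; first by rewrite su.
  rewrite tauw_cons tu; lia.
- by rewrite /= size_nseq.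
- by rewrite /= all_minuses.
- rewrite tauw_cons tauw_minuses; lia.
Qed.

Definition delta (w0 : word) (z : int) : word -> int :=
  fun w => if w == w0 then z else 0.

Lemma delta_bad w0 z : ~~ bad w0 -> kills_bad (delta w0 z).
Proof. by move=> g w bw; rewrite /delta; case: eqP => // E;
  rewrite -E bw in g. Qed.

Lemma bad_minuses k : bad (minuses k) = false.
Proof. by elim: k. Qed.

Section Degree.
Variables (n k j : nat).
Hypotheses (kj : (k + j)%N = n) (k2 : (1 < k)%N).
Local Notation D := (torus2 n).
Variables (a b : int).
Hypothesis ak : a = n%:Z - 2 * k%:Z.
Implicit Types c : chain D a b.
Local Notation T := (nseq j None).
Local Notation d_in := (@partial D (a + 2) a b).
Local Notation d_out := (@partial D a (a - 2) b).

Definition phi_minus c : int := minus_coef k T (chain_fun c).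
Definition phi_plus c : int := plus_coef k T (chain_fun c).

Fact phi_minus_zmod_morphism : zmod_morphism phi_minus.
Proof. by move=> c c'; rewrite /phi_minus /minus_coef chain_funB. Qed.
Fact phi_plus_zmod_morphism : zmod_morphism phi_plus.
Proof.
by move=> c c'; rewrite /phi_plus -plus_coefB; apply: eq_plus_coef => u _ _;
  rewrite chain_funB.
Qed.
HB.instance Definition _ :=
  GRing.isZmodMorphism.Build (chain D a b) int phi_minus
  phi_minus_zmod_morphism.
HB.instance Definition _ :=
  GRing.isZmodMorphism.Build (chain D a b) int phi_plus phi_plus_zmod_morphism.

Lemma nB_top u : size u = k -> all isSome u -> nB (u ++ T) = k.
Proof. by move=> su au; rewrite nB_cat nB_nseq nB_all ?addn0. Qed.

Lemma size_top u : size u = k -> size (u ++ T) = n.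
Proof. by move=> su; rewrite size_cat su size_nseq. Qed.

Lemma phi_minus_supp c : phi_minus c != 0 -> b = n%:Z - 4 * k%:Z.
Proof.
case/chain_fun_supp => _ _ _ ->; rewrite tauw_cat tauw_minuses tauw_nseq ak;
  lia.
Qed.

Lemma phi_plus_supp c : phi_plus c != 0 -> b = n%:Z - 4 * k%:Z + 4.
Proof.
move=> h; apply/eqP; apply: contraNT h => h;
  apply/eqP/plus_coef_tauw => u su au tu.
apply/eqP; apply: contraNT h => /chain_fun_supp[_ _ _ ->].
rewrite tauw_cat tu tauw_nseq ak; apply/eqP; lia.
Qed.

Lemma gens_nB (g : gens D a b) : nB (word_of (val g)) = k.
Proof.
have := gens_sigma g; lia.
Qed.

Lemma phi_minus_bdry (y : chain D (a + 2) b) : phi_minus (d_in y) = 0.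
Proof.
rewrite /phi_minus /minus_coef chain_fun_partial ?size_top ?nB_top ?size_nseq
  ?all_minuses //; last by lia.
by rewrite -/(minus_coef k T _) minus_coef_cyc_diff //; apply: chain_fun_bad.
Qed.

Lemma phi_plus_bdry (y : chain D (a + 2) b) :
  phi_plus (d_in y) = (1 + (-1) ^+ k.-1) * minus_coef k.-1 (nseq j.+1 None)
    (chain_fun y).
Proof.
transitivity (plus_coef k T (cyc_diff (chain_fun y))).
  apply: eq_plus_coef => u su au;
    rewrite chain_fun_partial ?size_top ?nB_top //; lia.
by case: k k2 => [|[|l]] // _; rewrite plus_coef_cyc_diff //;
  apply: chain_fun_bad.
Qed.

(** This is [cyclic_exact] in a fixed bidegree, where the coefficient maps of
    the other degrees vanish for lack of support. *)
Lemma bdry_criterion c : d_out c = 0 -> phi_minus c = 0 -> phi_plus c = 0 ->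
  exists z, d_in z = c.
Proof.
move=> cc c1 cX.
have [|k' j' kj' k'0|Y [kY _ HY]] := cyclic_exact (chain_fun_bad c) (n := n).
- exact: cyc_diff_cycle.
- have [kk|kk] := eqVneq k' k.
    by rewrite kk (_ : j' = j) //; lia.
  have z u : size u = k' -> all isSome u -> chain_fun c (u ++ nseq j' None) = 0.
    move=> su au; apply/eqP; apply: contraNT kk => /chain_fun_supp[_ _ + _].
    by rewrite nB_cat nB_nseq nB_all // su ak => ?; apply/eqP; lia.
  split; first by apply: z; rewrite ?size_nseq ?all_minuses.
  by rewrite -(plus_coef0 k' (nseq j' None)); apply: eq_plus_coef.
exists (@chain_of n (a + 2) b Y); apply/ffunP => g; have ng := gens_nB g.
have hg : hasB (word_of (val g)) by rewrite hasB_nB ng; lia.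
rewrite partial_chain_of // ?ng //; last by lia.
by rewrite HY ?size_word_of // chain_fun_val // -hasB_word_of.
Qed.

(** The boundary of [x] is killed by all coefficient maps, by hypothesis, so it
    is also the boundary of a function that vanishes on the words B^k A^j;
    subtracting that function turns [x] into a cycle with the same values
    there. *)
Lemma cycle_lift x : kills_bad x ->
  (forall k' j', (k' + j'.+1)%N = n -> (0 < k')%N ->
     (1 + (-1) ^+ k') * minus_coef k' (nseq j'.+1 None) x = 0) ->
  exists2 c, d_out c = 0 & forall u, size u = k -> all isSome u ->
     b = a + 2 * tauw u -> chain_fun c (u ++ T) = x (u ++ T).
Proof.
move=> kx px; pose z := cyc_diff x.
have kz : kills_bad z by apply: cyc_diff_bad.
have [|k' j' kj' k'0|Y [kY tY HY]] := cyclic_exact kz (n := n).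
- by move=> w _; apply: cyc_diffK.
- split; first exact: minus_coef_cyc_diff.
  case: k' kj' k'0 => [|[|l]] // kj' _.
    rewrite /= /z cyc_diff_le1 ?subr0 // /nB /= -/(nB _) nB_nseq //.
  by rewrite plus_coef_cyc_diff // px //; lia.
have kxY : kills_bad (fun w => x w - Y w).
  by move=> w bw; rewrite kx // kY // subrr.
exists (@chain_of n a b (fun w => x w - Y w)).
  apply/ffunP => g; have ng : nB (word_of (val g)) = k.+1.
    have := gens_sigma g; move: (nB _) => m; rewrite ak; clear; lia.
  rewrite partial_chain_of // ?ng //; last by lia.
  by rewrite cyc_diffB HY ?size_word_of // ?hasB_nB ?ng // subrr ffunE.
move=> u su au eb; rewrite chain_fun_chain_of ?tY ?subr0 // ?size_top //.
- by rewrite hasB_nB nB_top //; lia.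
- by rewrite nB_top.
- by rewrite tauw_cat tauw_nseq addr0.
Qed.

Lemma khovanov_other : b != n%:Z - 4 * k%:Z -> b != n%:Z - 4 * k%:Z + 4 ->
  forall h : khovanov D a b, h = 0.
Proof.
move=> b1 bX; apply: homology_zero => c cc; apply: (bdry_criterion cc).
  by apply/eqP; apply: contraNT b1 => /phi_minus_supp ->.
by apply/eqP; apply: contraNT bX => /phi_plus_supp ->.
Qed.

Section Minus.
Hypothesis b1 : b = n%:Z - 4 * k%:Z.

Lemma phi_plus0 c : phi_plus c = 0.
Proof. apply/eqP; apply: contraT => /phi_plus_supp; lia. Qed.

(** The generator with all circles - is never hit by a boundary. It is
    completed to a cycle when its own boundary in the next degree, with
    coefficient 1 + (-1)^k, is zero, either because k is odd or because there
    is no next degree. *)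
Lemma khovanov_minus :
  odd k || (j == 0%N) -> zmod_isomorphic (khovanov D a b) int.
Proof.
move=> ok; apply: (@iso_homology _ _ _ _ _ _ phi_minus) => [c cc|z].
  split=> [c1|[y <-]]; last exact: phi_minus_bdry.
  by apply: (bdry_criterion cc c1); exact: phi_plus0.
pose w0 := minuses k ++ T.
have [||c cc Hc] := @cycle_lift (delta w0 z).
- by apply: delta_bad; rewrite bad_cat bad_minuses bad_nseq.
- move=> k' j' kj' k0; rewrite /minus_coef /delta; case: eqP => [E|_];
  last by rewrite mulr0.
  have : nB (minuses k' ++ nseq j'.+1 None) = nB w0 by rewrite E.
  rewrite !nB_cat !nB_minuses !nB_nseq => kk.
  case/orP: ok => [ok|/eqP j0]; last by lia.
  have -> : k' = k by lia.
  by rewrite -signr_odd ok expr1 subrr mul0r.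
exists c => //; transitivity (chain_fun c (minuses k ++ T)) => //.
rewrite Hc ?size_nseq ?all_minuses //.
  by rewrite /delta eqxx.
by rewrite tauw_minuses b1 ak; lia.
Qed.

(** As k is even, the boundary of a chain has twice its [phi_minus] as
    coefficient in the next degree, hence [phi_minus] vanishes on cycles. *)
Lemma khovanov_minus_zero : ~~ odd k -> (0 < j)%N ->
  forall h : khovanov D a b, h = 0.
Proof.
move=> ek j0; apply: homology_zero => c cc.
apply: (bdry_criterion cc); last exact: phi_plus0.
have H := cyc_diff_cycle cc.
have : plus_coef k.+1 (nseq j.-1 None) (cyc_diff (chain_fun c)) = 0.
  rewrite -(plus_coef0 k.+1 (nseq j.-1 None)); apply: eq_plus_coef => u su _.
  by apply: H; rewrite size_cat su size_nseq; lia.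
rewrite /phi_minus; case: k j j0 ek k2 => [|l] // [|i] // _ el _.
rewrite plus_coef_cyc_diff; last exact: chain_fun_bad.
rewrite -signr_odd (negbTE el) expr0 => /eqP;
  rewrite mulf_eq0 => /orP[//|/eqP //].
Qed.
End Minus.

Section Plus.
Hypothesis bX : b = n%:Z - 4 * k%:Z + 4.

Lemma phi_minus0 c : phi_minus c = 0.
Proof. apply/eqP; apply: contraT => /phi_minus_supp; lia. Qed.

(** [cycle_lift] applies to any multiple of the word whose only + comes first,
    since every [minus_coef] vanishes on it. *)
Lemma phi_plus_onto z : exists2 c, d_out c = 0 & phi_plus c = z.
Proof.
pose w0 : word := Some 0%N :: minuses k.-1 ++ T.
have [||c cc Hc] := @cycle_lift (delta w0 z).
- by apply: delta_bad; rewrite /= -/(bad _) bad_cat bad_minuses bad_nseq.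
- move=> k' j' kj' k0; rewrite /minus_coef /delta; case: eqP => [E|_];
  last by rewrite mulr0.
  by case: k' k0 E {kj'}.
exists c => //.
have -> : phi_plus c = plus_coef k T (delta w0 z).
  apply/eqP; rewrite -subr_eq0 -plus_coefB;
    apply/eqP/plus_coef_tauw => u su au tu.
  by rewrite Hc ?subrr // tu bX ak; lia.
rewrite /w0; case: k k2 => // l _;
  rewrite plus_coefS /delta eqxx /= plus_coef_top0 ?subr0 //.
Qed.

(** The differential that arrives at the generator with one circle + has
    coefficient 1 + (-1)^(k-1) = 0. *)
Lemma khovanov_plus_even : ~~ odd k -> zmod_isomorphic (khovanov D a b) int.
Proof.
move=> ek; apply: (@iso_homology _ _ _ _ _ _ phi_plus) => [c cc|z];
  last exact: phi_plus_onto.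
split=> [cX|[y <-]].
  by apply: (bdry_criterion cc _ cX); exact: phi_minus0.
apply: etrans (phi_plus_bdry y) _; case: k k2 ek => // l _ /=;
  rewrite negbK => ol.
by rewrite -signr_odd ol expr1 subrr mul0r.
Qed.

Lemma d_outK (y : chain D (a + 2) b) : d_out (d_in y) = 0.
Proof.
apply/ffunP => g; have ng : nB (word_of (val g)) = k.+1.
  have := gens_sigma g; move: (nB _) => m; rewrite ak; clear; lia.
rewrite partialE total_diff_word ?ng //; last by lia.
rewrite -/(chain_fun _) (@eq_cyc_diff_in _ (cyc_diff (chain_fun y))) ?cyc_diffK
  ?ffunE // => w.
rewrite size_word_of => sw hw; have [nw|nw] := ltnP 1 (nB w).
  by rewrite chain_fun_partial // addrK.
rewrite cyc_diff_le1 //; apply/eqP; apply: contraT => /chain_fun_supp[_ _ + _].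
by rewrite ak; lia.
Qed.

(** The differential that arrives at the generator with one circle + has
    coefficient 2, and it starts from the word with k - 1 circles -. *)
Lemma khovanov_plus_odd : odd k -> zmod_isomorphic (khovanov D a b) 'Z_2.
Proof.
move=> ok; apply: (@iso_homology _ _ _ _ _ _ (intmul (1 : 'Z_2) \o
  phi_plus)) => [c cc|z]; last first.
  have [c cc cz] := phi_plus_onto (val z)%:Z; exists c => //=.
  by rewrite cz -pmulrn natr_Zp.
have sgk : 1 + (-1) ^+ k.-1 = 2 :> int.
  by case: k ok => // l /= ol; rewrite -signr_odd (negbTE ol) expr0.
rewrite /=; split=> [cX|[y <-]]; last first.
  have -> : phi_plus (d_in y) =
    2 * minus_coef k.-1 (nseq j.+1 None) (chain_fun y) by rewrite phi_plus_bdry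
    sgk.
  by rewrite intrM [2%:~R](_ : _ = 0) ?mul0r //; apply/eqP.
have [m cm] : exists m, phi_plus c = 2 * m.
  have : (2 %| phi_plus c)%Z.
    by rewrite (@dvdz_pcharf 'Z_2 2) ?cX // inE /=; apply/eqP.
  by case/dvdzP => m ->; exists m; rewrite mulrC.
pose w0 := minuses k.-1 ++ nseq j.+1 None.
pose y0 := @chain_of n (a + 2) b (delta w0 m).
have PXy : phi_plus (d_in y0) = 2 * m.
  rewrite phi_plus_bdry sgk /minus_coef chain_fun_chain_of ?/delta ?eqxx //.
  - by apply: delta_bad; rewrite bad_cat bad_minuses (bad_nseq j.+1).
  - by rewrite size_cat !size_nseq; lia.
  - by rewrite hasB_cat hasB_minuses; case: k k2 => [|[]].
  - by rewrite nB_cat nB_minuses (nB_nseq j.+1) ak; lia.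
  - by rewrite tauw_cat tauw_minuses (tauw_nseq j.+1) bX ak; lia.
have [|||y1 Hy1] := @bdry_criterion (c - d_in y0).
- rewrite raddfB cc; apply/eqP; rewrite subr_eq0 eq_sym; apply/eqP;
  exact: d_outK.
- exact: phi_minus0.
- by rewrite (phi_plus_zmod_morphism c (d_in y0)) cm PXy subrr.
exists (y0 + y1); apply: etrans (raddfD _ _ _) _.
by apply: etrans (congr1 _ Hy1) _; rewrite addrC subrK.
Qed.
End Plus.
End Degree.

(** * At most one B-smoothing *)

Section AllA.
Variable n : nat.
Hypothesis n_gt0 : (0 < n)%N.
Local Notation D := (torus2 n).
Implicit Types (S : EKS D) (a b : int).

Let v0 : 'I_n := Ordinal n_gt0.
Definition stateA : state D := [ffun=> mA].

Lemma hasBs_stateA : hasBs stateA = false.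
Proof. by apply/existsP => -[v]; rewrite ffunE. Qed.

Lemma circle_key_stateA (c : Defs.arc D) : circle_key stateA c = c.2.
Proof. by rewrite /circle_key hasBs_stateA. Qed.

Definition allA (p q : bool) : EKS D :=
  existT (fun s => {ffun circle s -> bool}) stateA
    [ffun C : circle stateA => if (v0, false) \in val C then p else q].

Lemma st_allA p q : st (allA p q) = stateA. Proof. by []. Qed.

Definition circle_top := circle_of stateA (v0, false).
Definition circle_bottom := circle_of stateA (v0, true).

Lemma circle_stateA (C : circle stateA) : C = circle_top \/ C = circle_bottom.
Proof.
have [[i []] ->] := circle_ofP C; [right|left]; apply: circle_of_eq;
  by rewrite !circle_key_stateA.
Qed.

Lemma sgn_allA0 p q : sgn (allA p q) circle_top = p.
Proof. by rewrite /sgn /= ffunE mem_circle_of eqxx. Qed.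
Lemma sgn_allA1 p q : sgn (allA p q) circle_bottom = q.
Proof. by rewrite /sgn /= ffunE mem_circle_of !circle_key_stateA. Qed.

Lemma noB_allA S : ~~ hasBs (st S) -> exists p q, S = allA p q.
Proof.
case: S => s g /existsPn h.
have Es : s = stateA.
  by apply/ffunP => v; rewrite ffunE; have := h v; rewrite /st /=; case: (s v).
subst s; exists (g circle_top), (g circle_bottom); congr existT;
  apply/ffunP => C; rewrite ffunE.
by have [->|->] := circle_stateA C;
  rewrite mem_circle_of ?eqxx // !circle_key_stateA.
Qed.

Definition sign_of (p : bool) : int := if p then 1 else -1.

Lemma tau_allA p q : tau (allA p q) = sign_of p + sign_of q.
Proof.
rewrite tau_sum (bigD1 circle_top) //= (bigD1 circle_bottom) /=; last first.
  apply/negP => /eqP E; have : (v0,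
    false) \in val circle_bottom by rewrite E mem_circle_of.
  by rewrite mem_circle_of !circle_key_stateA.
rewrite big_pred0 => [|C]; last by have [->|->] := circle_stateA C;
  rewrite eqxx ?andbF.
by rewrite sgn_allA0 sgn_allA1 addr0.
Qed.

Lemma nB_noB S : nB (word_of S) = 0%N -> ~~ hasBs (st S).
Proof. by rewrite -hasB_word_of hasB_nB => ->. Qed.

Lemma touches_stateA v (C : circle stateA) : touches (val C) v.
Proof.
apply/existsP; have [->|->] := circle_stateA C; [exists TL|exists BL];
  by rewrite mem_circle_of !circle_key_stateA /torus2_arc_at /=.
Qed.

(** Both circles of the state without B touch the changed crossing, so the
    value of tau is the only condition. *)
Lemma coeff_allA p q S' : nB (word_of S') = 1%N ->
  coeff (allA p q) S' = (tau S' == tau (allA p q) + 1)%:Z.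
Proof.
move=> nS'; have : #|[set v : 'I_n | st S' v == mB]| == 1%N by rewrite
  -nB_word_of nS'.
case/cards1P => v Ev; have s'v : st S' v = mB.
  by apply/eqP; have : v \in [set v] := set11 v; rewrite -Ev inE.
have inc (u : 'I_n) : @incident D u (allA p q) S' =
  (u == v) && (tau S' == tau (allA p q) + 1).
  have setv (w : 'I_n) : (st S' w == mB) = (w == v).
    by have /setP/(_ w) := Ev; rewrite !inE.
  have sAE (w : 'I_n) : st (allA p q) w = mA by exact: ffunE.
  apply/idP/andP => [h|[/eqP -> /eqP tt]].
    have [_ s'u _] := incident_markers h.
    by case/and5P: h => _ _ _ -> _; rewrite -setv s'u.
  apply/and5P; split; rewrite ?sAE ?s'v ?tt //.
    apply/forallP => w; apply/implyP => wv; rewrite sAE.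
    by have := setv w; rewrite (negbTE wv); case: (st S' w).
  apply/forallP => C; apply/forallP => C'; apply/implyP => /andP[_].
  by rewrite touches_stateA.
rewrite /coeff (eq_bigl _ _ inc); case: (tau S' == _); last first.
  by rewrite big_pred0 // => u; rewrite andbF.
rewrite (big_pred1 v) => [|u]; last by rewrite andbT.
rewrite /nB_after eq_card0 // => u.
by rewrite !inE st_allA ffunE andbF.
Qed.

Lemma tau_oneB S : nB (word_of S) = 1%N -> tau S = 1 \/ tau S = -1.
Proof.
move=> nS; have hs : hasBs (st S) by rewrite -hasB_word_of hasB_nB nS.
have hw : hasB (word_of S) by rewrite hasB_word_of.
rewrite tau_word_of //; have [u [e [j ew]]] := lastB hw.
move: nS (word_of_good S);
  rewrite ew nB_cat /nB /= -!/(nB _) nB_nseq bad_cat /= => nu.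
have hu : ~~ hasB u by rewrite hasB_nB; lia.
rewrite tauw_cat tauw_cons tauw_nseq (noB_nseq hu) tauw_nseq.
by case: e {ew} => [|[|e]] /=; rewrite ?orbT //; [left|right].
Qed.

Lemma oneB_exists e : (e < 2)%N ->
  exists S, [/\ nB (word_of S) = 1%N,
    tau S = 1 - 2 * e%:Z & word_of S = Some e :: nseq n.-1 None].
Proof.
move=> e2; have [||| S eS] := @word_of_surj n (Some e :: nseq n.-1 None).
- by rewrite /= size_nseq prednK.
- by [].
- by rewrite /= -/(bad _) bad_nseq orbF -leqNgt.
have nS : nB (word_of S) = 1%N by rewrite eS /nB /= -/(nB _) nB_nseq.
exists S; split => //; rewrite tau_word_of -?hasB_word_of ?hasB_nB ?nS // eS.
by rewrite tauw_cons tauw_nseq addr0.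
Qed.

(** The word with letters B of exponents e and 0 at the positions 0 and i + 1
    has two erasures, and they leave the words compared here, with opposite
    signs. *)
Lemma one_B_slide x i j e : kills_bad x ->
  cyc_diff x (Some e :: nseq i None ++ Some 0%N :: nseq j None) = 0 ->
  x (nseq i.+1 None ++ Some e :: nseq j None) =
  x (Some e :: nseq (i + j.+1) None).
Proof.
move=> kx; rewrite /cyc_diff -[_ :: _ ++ _]/((Some e :: nseq i None) ++ _)
  wrap_termE.
rewrite {1}[lin_diff _ _]/= hasB_cat /= orbT nB_cat /nB /= -!/(nB _) !nB_nseq.
rewrite absorb_catr ?hasB_nseq //= addn0.
have -> : lin_diff (fun v => x (Some e :: v)) (nseq i None ++ Some 0%N :: nseq
  j None) = 0.
  by rewrite lin_diff_cat ?hasB_nseq // lin_diff_noB ?hasB_nseq // subrr.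
by rewrite addr0 expr1 addn0 add0n nseqD /=; lia.
Qed.

Section One.
Variables a b : int.
Hypothesis ea : a = n%:Z - 2.
Local Notation d_in := (@partial D (a + 2) a b).
Local Notation d_out := (@partial D a (a - 2) b).

Lemma gens_one (g : gens D a b) : exists i j e,
  [/\ word_of (val g) = nseq i None ++ Some e :: nseq j None, (i + j.+1)%N = n,
      (e < 2)%N & b = a + 2 * (1 - 2 * e%:Z)].
Proof.
have ng : nB (word_of (val g)) = 1%N.
  by have := gens_sigma g; move: (nB _) => m; rewrite ea; clear; lia.
have hw : hasB (word_of (val g)) by rewrite hasB_nB ng.
have tg : b = a + 2 * tau (val g) by case: g {ng hw} => S /= /andP[/eqP <-
  /eqP].
have [u [e [j ew]]] := lastB hw.
have hu : ~~ hasB u.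
  by move: ng; rewrite ew nB_cat /nB /= -!/(nB _) nB_nseq hasB_nB; lia.
rewrite (noB_nseq hu) in ew; exists (size u), j, e; split => //.
- by rewrite -(size_word_of (val g)) ew size_cat /= !size_nseq.
- by have := word_of_good (val g);
  rewrite ew bad_cat /= negb_or negb_or -leqNgt => /and3P[].
- rewrite tg tau_word_of -?hasB_word_of // ew tauw_cat tauw_cons !tauw_nseq;
  lia.
Qed.

Lemma gens_one_val (c : chain D a b) (g : gens D a b) e : d_out c = 0 ->
  b = a + 2 * (1 - 2 * e%:Z) -> c g = chain_fun c (Some e :: nseq n.-1 None).
Proof.
move=> /cyc_diff_cycle H eb; have [i [j [f [ew ij _ eb']]]] := gens_one g.
have hs : hasBs (st (val g)) by rewrite -hasB_word_of ew hasB_cat /= orbT.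
have {eb eb'} ef : f = e by lia.
rewrite -(chain_fun_val c hs) {}ew {}ef; case: i ij => [|i] ij.
  by have -> : n.-1 = j by lia.
rewrite (one_B_slide (@chain_fun_bad _ _ _ c)) ?H ?/= ?size_cat ?/=
  ?size_nseq //.
by congr (chain_fun c (_ :: nseq _ _)); lia.
Qed.

(** By [one_B_slide] a cycle takes the same value on all the states of its
    bidegree. It is hit by a multiple of one state without B, since the
    multiplication of Z[X]/(X^2) is onto. *)
Lemma khovanov_one (h : khovanov D a b) : h = 0.
Proof.
move: h; apply: homology_zero => c cc.
have [g0|ng] := pickP (fun g : gens D a b => true); last first.
  exists 0; apply: etrans (raddf0 _) _.
  by apply/ffunP => g; have := ng g.
move=> _; have [_ [_ [e [_ _ e2 eb]]]] := gens_one g0.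
have [p [q tpq]] : exists p q, tau (allA p q) = - (2 * e%:Z).
  case: e e2 {eb} => [|[|e]] // _; [exists true, false | exists false, false];
    by rewrite tau_allA.
pose z S := if S == allA p q then chain_fun c (Some e :: nseq n.-1 None) else 0.
exists (restrict (a + 2) b z); apply/ffunP => g.
have tg : tau (val g) = 1 - 2 * e%:Z.
  have : b = a + 2 * tau (val g) by case: g => S /= /andP[/eqP <- /eqP].
  lia.
have ng : nB (word_of (val g)) = 1%N.
  by have := gens_sigma g; move: (nB _) => m; rewrite ea; clear; lia.
rewrite partialE total_diff_restrict; last by rewrite addrK; exact: (valP g).
rewrite /total_diff (bigD1 (allA p q)) //= big1 => [|S /negbTE Sn];
  last by rewrite /z Sn mul0r.
have -> : coeff (allA p q) (val g) =
  1 by rewrite coeff_allA // tg tpq addrC eqxx.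
rewrite /z eqxx mulr1 addr0.
by rewrite (gens_one_val g cc eb).
Qed.
End One.

Lemma allA_inj p q p' q' : allA p q = allA p' q' -> (p, q) = (p', q').
Proof.
pose F (t : bool) S :=
  [exists C : circle (st S), (((v0, t) : Defs.arc D) \in val C) && sgn S C].
have F0 r r' : F false (allA r r') = r.
  apply/existsP/idP => [[C]|rr].
    have [->|->] := circle_stateA C;
      rewrite ?sgn_allA0 ?sgn_allA1 mem_circle_of !circle_key_stateA //.
  by exists circle_top; rewrite sgn_allA0 mem_circle_of rr eqxx.
have F1 r r' : F true (allA r r') = r'.
  apply/existsP/idP => [[C]|rr].
    have [->|->] := circle_stateA C;
      rewrite ?sgn_allA0 ?sgn_allA1 mem_circle_of !circle_key_stateA //.
  by exists circle_bottom; rewrite sgn_allA1 mem_circle_of rr eqxx.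
by move=> E; have := F0 p q; have := F1 p q; rewrite E F0 F1 => <- <-.
Qed.

Lemma sum_allA (F : EKS D -> int) : (forall S, hasBs (st S) -> F S = 0) ->
  \sum_S F S = F (allA true true) + F (allA true false) + F (allA false true) +
    F (allA false false).
Proof.
move=> F0; transitivity (\sum_(S in [set allA r.1 r.2 | r in [set: bool *
  bool]]) F S).
  rewrite [LHS](bigID (fun S => S \in [set allA r.1 r.2 | r in [set: bool *
    bool]])) /=.
  rewrite [Z in _ + Z]big1 ?addr0 // => S; apply: contraNeq => FS.
  have [|p [q ->]] := @noB_allA S; first by apply: contra_neqN FS; apply: F0.
  by apply/imsetP; exists (p, q); rewrite ?inE.
rewrite big_imset /=; last by move=> [p q] [p' q'] _ _ /allA_inj.
rewrite (eq_bigl xpredT) => [|r]; last by rewrite inE.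
rewrite -(pair_bigA _ (fun p q => F (allA p q))) /= !big_bool /=; ring.
Qed.

Lemma sigma_allA p q : sigma (st (allA p q)) = n%:Z.
Proof.
rewrite sigma_card eq_card0 ?mulr0 ?subr0 // => v.
by rewrite !inE ffunE.
Qed.

Section Zero.
Variables b : int.
Local Notation a := (n%:Z).
Implicit Types c : chain D a b.
Local Notation d_in := (@partial D (a + 2) a b).
Local Notation d_out := (@partial D a (a - 2) b).

Lemma gens_zero (g : gens D a b) : exists p q,
  val g = allA p q /\ b = a + 2 * (sign_of p + sign_of q).
Proof.
have ng : nB (word_of (val g)) = 0%N.
  by have := gens_sigma g; move: (nB _) => m; lia.
have [p [q eg]] := noB_allA (nB_noB ng); exists p, q; split=> //.
by rewrite -tau_allA -eg; case: g {ng eg} => S /= /andP[/eqP <- /eqP].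
Qed.

Lemma d_in_zero (y : chain D (a + 2) b) : d_in y = 0.
Proof.
apply/ffunP => g; rewrite !ffunE big1 // => h _.
by have := gens_sigma h; move: (nB _) => m; lia.
Qed.

Lemma chain_zeroP c :
  (forall p q, b = a + 2 * (sign_of p + sign_of q) -> extend c (allA p q) = 0)
    -> c = 0.
Proof.
move=> h; apply/ffunP => g; have [p [q [eg eb]]] := gens_zero g.
by rewrite -extend_val eg h // ffunE.
Qed.

Lemma d_out_eq c S : nB (word_of S) = 1%N -> d_out c = 0 ->
  total_diff (extend c) S = 0.
Proof. by move=> nS cc; rewrite -extend_partial cc extend0. Qed.

Lemma extend_noB c S : hasBs (st S) -> extend c S = 0.
Proof.
move=> hs; apply/eqP; apply: contraT => /extend_deg/andP[/eqP + _].
by move: hs; rewrite sigma_word_of -hasB_word_of hasB_nB; lia.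
Qed.

Lemma total_diff_allA z S :
  (forall S', hasBs (st S') -> z S' = 0) -> nB (word_of S) = 1%N ->
  total_diff z S =
    z (allA true true) * (tau S == 3)%:Z + z (allA true false) * (tau S == 1)%:Z
  + z (allA false true) * (tau S == 1)%:Z
  + z (allA false false) * (tau S == -1)%:Z.
Proof.
move=> z0 nS; rewrite /total_diff sum_allA => [|S' /z0 ->];
  last by rewrite mul0r.
by rewrite !coeff_allA // !tau_allA.
Qed.

Lemma tau_oneB_cases S : nB (word_of S) = 1%N -> (tau S == 3) = false.
Proof. by case/tau_oneB => ->. Qed.

(** The group of chains that maps to this degree is zero, so the homology is
    the group of cycles. A cycle is determined by its value at one state, and
    [lift] gives the inverse of this evaluation. *)
Lemma khovanov_zero_iso p q (lift : int -> EKS D -> int) :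
  b = a + 2 * (sign_of p + sign_of q) ->
  (forall m S, hasBs (st S) -> lift m S = 0) ->
  (forall m, lift m (allA p q) = m) ->
  (forall m S, nB (word_of S) = 1%N -> total_diff (lift m) S = 0) ->
  (forall c, d_out c = 0 -> extend c (allA p q) = 0 -> c = 0) ->
  zmod_isomorphic (khovanov D a b) int.
Proof.
move=> eb lift0 lift_pq dlift inj.
pose phi c := extend c (allA p q).
have phi_add : zmod_morphism phi.
  move=> c c'; apply/eqP; rewrite /phi eq_sym subr_eq -extendD subrK;
    exact: eqxx.
pose phiA := HB.pack_for {additive chain D a b -> int} phi
  (GRing.isZmodMorphism.Build _ _ phi phi_add).
apply: (@iso_homology _ _ _ _ _ _ phiA) => [c cc|m].
  split=> [/(inj c cc) ->|[y <-]]; first by exists 0; exact: raddf0.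
  have E : phi (d_in y) = 0 by rewrite /phi d_in_zero extend0.
  exact: E.
exists (restrict a b (lift m)).
  apply/ffunP => g; rewrite [RHS]ffunE partialE total_diff_restrict ?dlift //;
    last exact: (valP g).
  by have := gens_sigma g; move: (nB _) => l; lia.
have E : phi (restrict a b (lift m)) = m; last exact: E.
rewrite /phi extend_restrict ?lift_pq // /deg tau_allA sigma_allA -eb !eqxx //.
Qed.

Lemma khovanov_zero_plus : b = a + 4 -> zmod_isomorphic (khovanov D a b) int.
Proof.
move=> eb; have ab : b = a + 2 * (sign_of true + sign_of true) by rewrite eb.
apply: (@khovanov_zero_iso true true (fun m S => if S == allA true true then m
  else 0)).
- exact: ab.
- by move=> m S; case: eqP => // ->; rewrite hasBs_stateA.
- by move=> m; rewrite eqxx.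
- move=> m S nS; rewrite total_diff_allA => [|S'|] //;
  last by case: eqP => // ->; rewrite hasBs_stateA.
  have ne p q : (p, q) != (true, true) -> (allA p q == allA true true) = false.
    by move=> h; apply/negP => /eqP/allA_inj E; rewrite E eqxx in h.
  by rewrite tau_oneB_cases // eqxx !ne //= mulr0 !mul0r.
- move=> c _ c0; apply: chain_zeroP => p q h;
  have {h} : sign_of p + sign_of q = 2 by lia.
  by case: p; case: q => //= h; exfalso; rewrite /sign_of in h; lia.
Qed.

(** The cycles are spanned by the difference of the two states with one circle
    + and one circle -, whose products agree. *)
Lemma khovanov_zero_mid : b = a -> zmod_isomorphic (khovanov D a b) int.
Proof.
move=> eb; have ab : b =
  a + 2 * (sign_of true + sign_of false) by rewrite eb addr0.
apply: (@khovanov_zero_iso true false (fun m S =>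
  if S == allA true false then m else if S == allA false true then - m else 0)).
- exact: ab.
- by move=> m S; case: eqP => [->|_]; [|case: eqP => // ->];
  rewrite hasBs_stateA.
- by move=> m; rewrite eqxx.
- move=> m S nS; rewrite total_diff_allA => [|S'|] //; last first.
    by case: eqP => [->|_]; [|case: eqP => // ->]; rewrite hasBs_stateA.
  have ne p q p' q' : (p, q) != (p', q') -> (allA p q == allA p' q') = false.
    by move=> h; apply/negP => /eqP/allA_inj E; rewrite E eqxx in h.
  by rewrite !eqxx !ne //; ring.
- move=> c cc c0; apply: chain_zeroP => p q h;
  have {h} : sign_of p + sign_of q = 0 by lia.
  have [S [nS tS _]] := @oneB_exists 0%N isT.
  have := d_out_eq nS cc; rewrite (total_diff_allA (@extend_noB c) nS).
  rewrite tS /= c0 mul0r mulr0 mulr1 mulr0 !addr0 !add0r => c1.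
  by case: p; case: q => //= h; exfalso; rewrite /sign_of in h; lia.
Qed.

Lemma khovanov_zero_other :
  b != a + 4 -> b != a -> forall h : khovanov D a b, h = 0.
Proof.
move=> b4 b0; apply: homology_zero => c cc; exists 0.
apply: etrans (raddf0 _) _; apply/esym/chain_zeroP => p q eb.
have [S [nS tS _]] := @oneB_exists 1%N isT.
have := d_out_eq nS cc; rewrite (total_diff_allA (@extend_noB c) nS).
rewrite tS /= !mulr0 mulr1 !add0r => c1.
by case: p eb; case: q => //= h; exfalso; rewrite /sign_of in h; lia.
Qed.
End Zero.
End AllA.

(** * The homology of T(2,n) *)

Lemma khovanov_no_state n a b :
  (forall k, (k <= n)%N -> a <> n%:Z - 2 * k%:Z) ->
  forall h : khovanov (torus2 n) a b, h = 0.
Proof.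
move=> na; apply: homology_zero => c _; exists 0.
apply: etrans (raddf0 _) _; apply/ffunP => g.
have le : (nB (word_of (val g)) <= n)%N.
  by apply: leq_trans (count_size _ _) _; rewrite size_word_of.
by case: (na _ le); exact: gens_sigma.
Qed.

(* At (-n, -3n) the condition n > 1 is needed: for n = 1 (a one-crossing
   diagram of the unknot) the homology vanishes there. *)
Theorem theorem6p2 (n : nat) (n_gt0 : (0 < n)%N) (a b : int) :
  let H := khovanov (torus2 n) a b in
  let Z_ends :=
    (a = n%:Z /\ b = n%:Z) \/
    ((1 < n)%N /\ a = - n%:Z /\ b = - (3 * n%:Z)) in
  let Z_even := exists s : nat,
    [/\ ~~ odd s, (0 <= s <= n)%N,
        a = n%:Z - 2 * s%:Z & b = n%:Z - 4 * s%:Z + 4] in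
  let Z_odd := exists s : nat,
    [/\ odd s, (3 <= s <= n)%N,
        a = n%:Z - 2 * s%:Z & b = n%:Z - 4 * s%:Z] in
  let Z2_odd := exists s : nat,
    [/\ odd s, (3 <= s <= n)%N,
        a = n%:Z - 2 * s%:Z & b = n%:Z - 4 * s%:Z + 4] in
  [/\ Z_ends \/ Z_even \/ Z_odd -> zmod_isomorphic H int,
      Z2_odd -> zmod_isomorphic H 'Z_2
    & ~ (Z_ends \/ Z_even \/ Z_odd \/ Z2_odd) -> forall x : H, x = 0].
Proof.
move=> H Z_ends Z_even Z_odd Z2_odd.
have [[k kn] /= /eqP ak|na] := pickP (fun k : 'I_n.+1 => a == n%:Z - 2 * k%:Z);
  last first.
  have na' k : (k <= n)%N -> a <> n%:Z - 2 * k%:Z.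
    by move=> kn ak; have /eqP[] := na (Ordinal (kn : (k < n.+1)%N)).
  split=> [zz|[s [_ /andP[_ sn] /(na' s sn)[]]]|_];
    last exact: khovanov_no_state.
  exfalso; case: zz => [[[e _]|[_ [e _]]]|[[s [_ sn e _]]|[s [_ sn e _]]]].
  - by apply: (na' 0%N); lia.
  - by apply: (na' n); lia.
  - by apply: (na' s); lia.
  - by apply: (na' s); lia.
(* [k] is the number of B-smoothings in degree [a] *)
case: k kn ak => [|[|k]] kn ak.
- have {}ak : a = n%:Z by lia.
  have zz : Z_ends \/ Z_even \/ Z_odd -> b = n%:Z \/ b = n%:Z + 4.
    by case=> [[[_ e]|[_ [e _]]]|[[s [_ _ e e']]|[s [_ /andP[s3 _] e _]]]]; lia.
  rewrite {}/H {}/Z2_odd; subst a;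
    split=> [/zz[eb|eb]|[s [_ /andP[s3 _] e _]]|nz].
  - exact: khovanov_zero_mid.
  - exact: khovanov_zero_plus.
  - by exfalso; lia.
  - apply: khovanov_zero_other => //; apply/eqP => eb; apply: nz.
      by right; left; exists 0%N; split=> //; lia.
    by left; left.
- have {}ak : a = n%:Z - 2 by lia.
  have zz : ~ (Z_ends \/ Z_even \/ Z_odd).
    case=> [[[e _]|[n1 [e _]]]|[[s [es _ e _]]|[s [_ /andP[s3 _] e _]]]]; lia.
  split=> [/zz []|[s [_ /andP[s3 _] e _]]|_]; first by exfalso; lia.
  exact: khovanov_one.
have m2 : (1 < k.+2)%N by [].
move: k.+2 m2 kn ak => m m2 kn ak.
have mj : (m + (n - m))%N = n by lia.
have sm s : a = n%:Z - 2 * s%:Z -> s = m by lia.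
have [b1|b1] := eqVneq b (n%:Z - 4 * m%:Z).
  have noX : b <> n%:Z - 4 * m%:Z + 4 by lia.
  have [ok|nok] := boolP (odd m || (n - m == 0)%N).
    split=> [_|[s [_ _ /sm -> /noX []]]|[]]; first exact: (khovanov_minus mj).
    case/orP: ok => [om|/eqP n0]; last by left; right; do !split; lia.
    have m3 : (3 <= m)%N by lia.
    by right; right; left; exists m; split; rewrite ?m3.
  move: nok; rewrite negb_or => /andP[em n0].
  split=> [zz|[s [_ _ /sm -> /noX []]]|_]; last first.
    by apply: (khovanov_minus_zero mj) => //; lia.
  exfalso; case: zz => [[[e _]|[_ [e _]]]|[[s [_ _ /sm -> /noX []]]|[s [os _
    /sm E _]]]].
  - by lia.
  - by lia.
  - by rewrite -E os in em.
have [bX|bX] := eqVneq b (n%:Z - 4 * m%:Z + 4).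
  have [om|em] := boolP (odd m).
    have m3 : (3 <= m)%N by lia.
    split=> [zz|_|[]]; last by right; right; right; exists m; split;
      rewrite ?m3.
      exfalso; case: zz => [[[e _]|[_ [e e']]]|[[s [es _ /sm E _]]|[s [_ _ /sm
        -> e]]]]; lia.
    exact: (khovanov_plus_odd mj).
  split=> [_|[s [os _ /sm E _]]|[]]; first exact: (khovanov_plus_even mj).
    by rewrite -E os in em.
  by right; left; exists m; split=> //; lia.
split=> [zz|[s [_ _ /sm -> e]]|_]; last exact: (khovanov_other mj).
  exfalso; case: zz => [[[e _]|[_ [e e']]]|[[s [_ _ /sm -> e]]|[s [_ _ /sm ->
    e]]]]; lia.
by rewrite e eqxx in bX.
Qed.
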